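(* Let $H$ be a finite weakly nilpotent hypergroup. Assume that $H$ is residually thin and $p$-valenced for some prime $p$ dividing $n_H$. Then every Sylow $p$-subset $P$ of $H$ is strongly normal in $H$.
   Context: A hypergroup is a set $H$ with a hypermultiplication, i.e. a map $H\times H\to \mathcal P(H)$, $(p,q)\mapsto pq$ (the power set of $H$), where for subsets $P,Q\subseteq H$ one puts $PQ:=\bigcup_{p\in P,q\in Q}pq$, and $pQ:=\{p\}Q$, $Qp:=Q\{p\}$, such that: (i) $p(qr)=(pq)r$ for all $p,q,r\in H$; (ii) there is an element $1\in H$ with $s1=\{s\}$ for all $s\in H$; (iii) for each $s\in H$ there is an element $s^*\in H$ such that for all $p,q,r\in H$ with $r\in pq$ one has $q\in p^*r$ and $p\in rq^*$. A singleton $\{s\}$ is sometimes written $s$. For $S\subseteq H$, $S^*:=\{s^*: s\in S\}$. An element $s\in H$ is thin if $s^*s=\{1\}$; $O_\vartheta(H)$ is the set of thin elements of $H$, and $H$ is thin if $H=O_\vartheta(H)$. A nonempty subset $F\subseteq H$ is closed if $F^*F\subseteq F$; a closed subset is itself a hypergroup under the restricted hypermultiplication. A closed subset $F$ of $H$ is normal in $H$ if $Fh\subseteq hF$ for all $h\in H$, and strongly normal in $H$ if $h^*Fh\subseteq F$ for all $h\in H$. It is subnormal in $H$ if there is a chain of closed subsets $F=F_0\subseteq F_1\subseteq\cdots\subseteq F_n=H$ with $n>0$ and $F_{i-1}$ normal in $F_i$ for all $1\le i\le n$. Quotient: for a closed subset $F$ of $H$ and $h\in H$ put $h^F:=FhF$,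 and for $F\subseteq S\subseteq H$ put $S//F:=\{h^F: h\in S\}$. With $a^F\cdot b^F:=\{x^F: x\in aFb\}$ the set $H//F$ is a hypergroup, with identity $1^F=F$ and $(h^F)^*=(h^* )^F$. Centre: $Z(H):=\{h\in H: hx=xh \text{ for all } x\in H,\ h^*h=\{1\}\}$. Upper center series: $Z_0(H)=\{1\}$, and for $i\ge1$, $Z_i(H)$ is determined by $Z_i(H)//Z_{i-1}(H)=Z(H//Z_{i-1}(H))$, i.e. $Z_i(H)=\{h\in H: h^{Z_{i-1}(H)}\in Z(H//Z_{i-1}(H))\}$; each $Z_i(H)$ is a normal closed subset of $H$. $H$ is weakly nilpotent if $Z_n(H)=H$ for some non-negative integer $n$. $H$ is residually thin (RT) if there is a chain of closed subsets $\{1\}=F_0\subset F_1\subset\cdots\subset F_n=H$ with $F_i//F_{i-1}$ thin for all $1\le i\le n$; the valency of a finite RT hypergroup $H$ is the integer $n_H=\prod_{i=1}^n|F_i//F_{i-1}|$ (independent of the chain). Closed subsets of finite RT hypergroups are RT, so they have valencies too. A $p$-number is a power of $p$ (including $1$); a $p'$-number is a positive integer not divisible by $p$. An element $h$ of a finite RT hypergroup $H$ is $p$-valenced if for every subnormal closed subset $U$ of $H$ such that $n_U$ is a $p$-number and $(h^* )^Uh^U\subseteq O_\vartheta(H//U)$, the number $n_{(h^* )^Uh^U}=|(h^* )^Uh^U|$ is a $p$-number. $H$ is $p$-valenced if all its elements are $p$-valenced. A $p$-subset of $H$ is a closed subset $C$ such that $n_C$ is a $p$-number; a Sylow $p$-subset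 of $H$ is a $p$-subset $C$ such that $n_H/n_C$ is a $p'$-number. *)

(* Defs.v *)
From mathcomp Require Import all_boot.

Set Implicit Arguments.
Unset Strict Implicit.
Unset Printing Implicit Defensive.

(* A hypergroup lives on a subset [car] of an ambient finite type, so that a
   closed subset is a hypergroup over the same type and a quotient one over
   [{set T}].  The values of the operations outside [car] are irrelevant.
   The identity and the map s |-> s^* are data; the axioms below determine
   them uniquely on [car]. *)
Record hyperstruct (T : finType) := Hyperstruct {
  car : {set T};
  hmul : T -> T -> {set T};
  hone : T;
  hinv : T -> T
}.

Section Hypergroups.

Variable T : finType.
Implicit Types (H : hyperstruct T) (P Q F S U : {set T}) (h s : T).

Definition hmulS H P Q : {set T} :=
  \bigcup_(p in P) \bigcup_(q in Q) hmul H p q.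

Definition hinvS H S : {set T} := [set hinv H s | s in S].

Record hypergroup H : Prop := {
  hone_in : hone H \in car H;
  hinv_in : {in car H, forall s, hinv H s \in car H};
  hmul_sub : {in car H &, forall p q, hmul H p q \subset car H};
  hmulA : {in car H & &, forall p q r,
    hmulS H [set p] (hmul H q r) = hmulS H (hmul H p q) [set r]};
  hmulr1 : {in car H, forall s, hmul H s (hone H) = [set s]};
  hmul_exch : {in car H & &, forall p q r, r \in hmul H p q ->
    q \in hmul H (hinv H p) r /\ p \in hmul H r (hinv H q)}
}.

Definition thin_elts H : {set T} :=
  [set s in car H | hmul H (hinv H s) s == [set hone H]].

Definition thin H : bool := car H == thin_elts H.

Definition hclosed H F : bool :=
  [&& F \subset car H, F != set0 & hmulS H (hinvS H F) F \subset F].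

Definition subhyper H F : hyperstruct T :=
  Hyperstruct F (hmul H) (hone H) (hinv H).

Definition hnormal H F : bool :=
  hclosed H F &&
  [forall h in car H, hmulS H F [set h] \subset hmulS H [set h] F].

Definition strongly_normal H F : bool :=
  hclosed H F &&
  [forall h in car H,
     hmulS H (hmulS H [set hinv H h] F) [set h] \subset F].

Definition subnormal_step H : rel {set T} :=
  fun A B => hclosed H B && hnormal (subhyper H B) A.

Definition hsubnormal H F : Prop :=
  exists s : seq {set T},
    [/\ s != [::], hclosed H F, path (subnormal_step H) F s
      & last F s = car H].

Definition dcoset H F h : {set T} := hmulS H (hmulS H F [set h]) F.

Definition center H : {set T} :=
  [set h in car H | [forall x in car H, hmul H h x == hmul H x h]
                    && (hmul H (hinv H h) h == [set hone H])].

End Hypergroups.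

(* The product and the inverse are unions over all representatives of the
   given double cosets; for closed F they do not depend on the
   representatives, see [hmul_quot] and [hinv_quot]. *)
Definition hquot (T : finType) (H : hyperstruct T) (F : {set T}) :
    hyperstruct {set T} :=
  Hyperstruct
    [set dcoset H F h | h in car H]
    (fun A B =>
       \bigcup_(a in car H | dcoset H F a == A)
       \bigcup_(b in car H | dcoset H F b == B)
         [set dcoset H F x | x in hmulS H (hmulS H [set a] F) [set b]])
    F
    (fun A => \bigcup_(a in car H | dcoset H F a == A) dcoset H F (hinv H a)).

Section Main.

Variable T : finType.
Implicit Types (H : hyperstruct T) (P F U : {set T}) (p n i : nat).

Fixpoint upper_center H i : {set T} :=
  if i is j.+1 then
    let Z := upper_center H j in
    [set h in car H | dcoset H Z h \in center (hquot H Z)]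
  else [set hone H].

Definition weakly_nilpotent H : Prop := exists n, upper_center H n = car H.

Definition rt_step H : rel {set T} :=
  fun A B => [&& hclosed H A, hclosed H B, A \proper B
               & thin (hquot (subhyper H B) A)].

(* The sequence [s] is F_1, ..., F_n. *)
Definition rt_chain H (s : seq {set T}) : bool :=
  path (rt_step H) [set hone H] s && (last [set hone H] s == car H).

Definition residually_thin H : Prop := exists s, rt_chain H s.

Definition chain_valency H (s : seq {set T}) : nat :=
  \prod_(AB <- zip ([set hone H] :: s) s)
    #|car (hquot (subhyper H AB.2) AB.1)|.

(* An arbitrary chain is picked, the product being independent of it; the
   valency is 0 if H is not residually thin.  Chains are strict, hence have
   at most #|T| steps, see [valency_gt0]. *)
Definition valency H : nat :=
  if [pick s : #|T|.-bseq {set T} | rt_chain H s] is Some s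
  then chain_valency H s else 0.

Definition p_number p n : Prop := exists k, n = p ^ k.

Definition p'_number p n : Prop := 0 < n /\ ~~ (p %| n).

Definition p_valenced_elt p H (h : T) : Prop :=
  forall U, hclosed H U -> hsubnormal H U ->
    p_number p (valency (subhyper H U)) ->
    let hh := hmul (hquot H U) (dcoset H U (hinv H h)) (dcoset H U h) in
    hh \subset thin_elts (hquot H U) -> p_number p #|hh|.

Definition p_valenced p H : Prop :=
  forall h, h \in car H -> p_valenced_elt p H h.

Definition p_subset p H P : Prop :=
  hclosed H P /\ p_number p (valency (subhyper H P)).

Definition sylow_subset p H P : Prop :=
  p_subset p H P /\
  (valency (subhyper H P) %| valency H /\
   p'_number p (valency H %/ valency (subhyper H P))).

End Main.

Section QuotientFacts.

Variables (T : finType) (H : hyperstruct T).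
Implicit Types (P Q R : {set T}).

Lemma hmulSP P Q x :
  reflect (exists p q, [/\ p \in P, q \in Q & x \in hmul H p q])
          (x \in hmulS H P Q).
Proof.
apply: (iffP bigcupP) => [[p Pp /bigcupP[q Qq xpq]]|[p [q [Pp Qq xpq]]]].
  by exists p, q.
by exists p => //; apply/bigcupP; exists q.
Qed.

Lemma hmulS_mem P Q p q x :
  p \in P -> q \in Q -> x \in hmul H p q -> x \in hmulS H P Q.
Proof. by move=> Pp Qq xpq; apply/hmulSP; exists p, q. Qed.

Lemma hmulSS P Q P' Q' :
  P \subset P' -> Q \subset Q' -> hmulS H P Q \subset hmulS H P' Q'.
Proof.
move=> /subsetP sP /subsetP sQ; apply/subsetP=> x /hmulSP[p [q [Pp Qq xpq]]].
by apply: hmulS_mem xpq; [apply: sP | apply: sQ].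
Qed.

Lemma hmulS11 p q : hmulS H [set p] [set q] = hmul H p q.
Proof. by rewrite /hmulS !big_set1. Qed.

Hypothesis hypH : hypergroup H.

Lemma hmulS_sub P Q :
  P \subset car H -> Q \subset car H -> hmulS H P Q \subset car H.
Proof.
move=> /subsetP sP /subsetP sQ; apply/subsetP=> x /hmulSP[p [q [Pp Qq]]].
by apply/subsetP/(hmul_sub hypH); [apply: sP | apply: sQ].
Qed.

Lemma hmulSA P Q R :
    P \subset car H -> Q \subset car H -> R \subset car H ->
  hmulS H P (hmulS H Q R) = hmulS H (hmulS H P Q) R.
Proof.
move=> /subsetP sP /subsetP sQ /subsetP sR; apply/setP=> x.
apply/hmulSP/hmulSP => -[].
  move=> p [y [Pp /hmulSP[q [r [Qq Rr yqr]]] xpy]].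
  have [Hp Hq Hr] := And3 (sP _ Pp) (sQ _ Qq) (sR _ Rr).
  have: x \in hmulS H (hmul H p q) [set r].
    by rewrite -(hmulA hypH) //; apply: (hmulS_mem (set11 _) yqr xpy).
  move=> /hmulSP[z [r' [zpq]]]; rewrite inE => /eqP-> xzr.
  by exists z, r; split=> //; apply: hmulS_mem zpq.
move=> y [r [/hmulSP[p [q [Pp Qq ypq]]] Rr xyr]].
have [Hp Hq Hr] := And3 (sP _ Pp) (sQ _ Qq) (sR _ Rr).
have: x \in hmulS H [set p] (hmul H q r).
  by rewrite (hmulA hypH) //; apply: (hmulS_mem ypq (set11 _) xyr).
move=> /hmulSP[p' [z []]]; rewrite inE => /eqP-> zqr xpz.
by exists p, z; split=> //; apply: hmulS_mem zqr.
Qed.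

Lemma hinvK : {in car H, forall s, hinv H (hinv H s) = s}.
Proof.
move=> s Hs; have H1 := hone_in hypH; have Hs' := hinv_in hypH Hs.
have s1: s \in hmul H s (hone H) by rewrite (hmulr1 hypH) ?inE.
have [e _] := hmul_exch hypH Hs H1 Hs s1.
have [] := hmul_exch hypH Hs' Hs H1 e.
by rewrite (hmulr1 hypH) ?(hinv_in hypH) // inE => /eqP <-.
Qed.

Lemma hone_hmulVs s : s \in car H -> hone H \in hmul H (hinv H s) s.
Proof.
move=> Hs; have H1 := hone_in hypH.
have s1: s \in hmul H s (hone H) by rewrite (hmulr1 hypH) ?inE.
by have [] := hmul_exch hypH Hs H1 Hs s1.
Qed.

Lemma hinv1 : hinv H (hone H) = hone H.
Proof.
have H1 := hone_in hypH; have := hone_hmulVs H1.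
by rewrite (hmulr1 hypH) ?(hinv_in hypH) // inE => /eqP.
Qed.

Lemma hmul1s : {in car H, forall s, hmul H (hone H) s = [set s]}.
Proof.
move=> s Hs; have H1 := hone_in hypH; have Hs' := hinv_in hypH Hs.
apply/setP=> x; rewrite inE; apply/idP/eqP => [x1s|->].
  have Hx := subsetP (hmul_sub hypH H1 Hs) x x1s.
  have [_ e] := hmul_exch hypH H1 Hs Hx x1s.
  have [+ _] := hmul_exch hypH Hx Hs' H1 e.
  rewrite (hmulr1 hypH) ?(hinv_in hypH) // inE => /eqP e'.
  by rewrite -(hinvK Hx) -e' hinvK.
have := hone_hmulVs Hs'; rewrite hinvK // => e.
by have [_] := hmul_exch hypH Hs Hs' H1 e; rewrite hinvK.
Qed.

Lemma hinv_hmul : {in car H &, forall p q r, r \in hmul H p q ->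
  hinv H r \in hmul H (hinv H q) (hinv H p)}.
Proof.
move=> p q Hp Hq r rpq; have Hr := subsetP (hmul_sub hypH Hp Hq) r rpq.
have [e _] := hmul_exch hypH Hp Hq Hr rpq.
have [_ e'] := hmul_exch hypH (hinv_in hypH Hp) Hr Hq e.
by have [] := hmul_exch hypH Hq (hinv_in hypH Hr) (hinv_in hypH Hp) e'.
Qed.

Variable F : {set T}.
Hypothesis clF : hclosed H F.

Let sF : F \subset car H. Proof. by have /and3P[] := clF. Qed.
Let inF x : x \in F -> x \in car H. Proof. exact: subsetP. Qed.

Let mVF x y z : x \in F -> y \in F -> z \in hmul H (hinv H x) y -> z \in F.
Proof.
have /and3P[_ _ /subsetP sFF] := clF => Fx Fy zxy.
by apply: sFF; apply: hmulS_mem zxy => //; apply: imset_f.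
Qed.

Lemma hclosed1 : hone H \in F.
Proof.
have /and3P[_ /set0Pn[f Ff] _] := clF.
exact: (mVF Ff Ff (hone_hmulVs (inF Ff))).
Qed.

Lemma hclosedV x : x \in F -> hinv H x \in F.
Proof.
move=> Fx; apply: (mVF Fx hclosed1).
by rewrite (hmulr1 hypH) ?inE // (hinv_in hypH) ?inF.
Qed.

Lemma hclosedM x y z : x \in F -> y \in F -> z \in hmul H x y -> z \in F.
Proof.
by move=> Fx Fy; rewrite -{1}(hinvK (inF Fx)); apply: mVF; rewrite ?hclosedV.
Qed.

Lemma hypergroup_sub : hypergroup (subhyper H F).
Proof.
split=> /=; first exact: hclosed1.
- exact: hclosedV.
- by move=> p q Fp Fq; apply/subsetP=> x; apply: hclosedM.
- by move=> p q r Fp Fq Fr; apply: (hmulA hypH); apply: inF.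
- by move=> s Fs; apply: (hmulr1 hypH); apply: inF.
by move=> p q r Fp Fq Fr; apply: (hmul_exch hypH); apply: inF.
Qed.

Let mFF : hmulS H F F = F.
Proof.
apply/eqP; rewrite eqEsubset; apply/andP; split.
  by apply/subsetP=> x /hmulSP[p [q [Fp Fq]]]; apply: hclosedM.
apply/subsetP=> x Fx; apply: (hmulS_mem Fx hclosed1).
by rewrite (hmulr1 hypH) ?inE ?inF.
Qed.

Lemma hmulS1s P : P \subset car H -> P \subset hmulS H F P.
Proof.
move=> /subsetP sP; apply/subsetP=> x Px; apply: (hmulS_mem hclosed1 Px).
by rewrite hmul1s ?inE ?sP.
Qed.

Lemma hmulSs1 P : P \subset car H -> P \subset hmulS H P F.
Proof.
move=> /subsetP sP; apply/subsetP=> x Px; apply: (hmulS_mem Px hclosed1).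
by rewrite (hmulr1 hypH) ?inE ?sP.
Qed.

Lemma dcosetP h x :
  reflect (exists f g y, [/\ f \in F, g \in F, y \in hmul H f h
                           & x \in hmul H y g])
          (x \in dcoset H F h).
Proof.
apply: (iffP (hmulSP _ _ _)) => [[y [g []]]|[f [g [y [Ff Fg yfh xyg]]]]].
  by move=> /hmulSP[f [h' [Ff /set1P-> yfh]]] Fg xyg; exists f, g, y.
by exists y, g; split=> //; apply: hmulS_mem yfh; rewrite ?inE.
Qed.

Lemma dcoset_sub h : h \in car H -> dcoset H F h \subset car H.
Proof. by move=> Hh; rewrite !hmulS_sub // sub1set. Qed.

Lemma dcoset_refl h : h \in car H -> h \in dcoset H F h.
Proof.
move=> Hh; rewrite -sub1set.
by rewrite (subset_trans (hmulS1s _)) ?hmulSs1 ?hmulS_sub // ?sub1set.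
Qed.

Lemma dcoset_sym x h : h \in car H -> x \in dcoset H F h -> h \in dcoset H F x.
Proof.
move=> Hh xh; have Hx := subsetP (dcoset_sub Hh) x xh.
have /dcosetP[f [g [y [Ff Fg yfh xyg]]]] := xh.
have Hy := subsetP (hmul_sub hypH (inF Ff) Hh) y yfh.
have [h1 _] := hmul_exch hypH (inF Ff) Hh Hy yfh.
have [_ y1] := hmul_exch hypH Hy (inF Fg) Hx xyg.
rewrite /dcoset -hmulSA ?sub1set //.
apply: hmulS_mem h1; first exact: hclosedV.
by apply: hmulS_mem y1; rewrite ?inE ?hclosedV.
Qed.

Lemma dcosetS x h : h \in car H -> x \in dcoset H F h ->
  dcoset H F x \subset dcoset H F h.
Proof.
move=> Hh xh; have Hx := subsetP (dcoset_sub Hh) x xh.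
have h1 : [set h] \subset car H by rewrite sub1set.
have Fh : hmulS H F [set h] \subset car H by rewrite hmulS_sub.
have <- : hmulS H (hmulS H F (dcoset H F h)) F = dcoset H F h.
  rewrite /dcoset (hmulSA (Q := hmulS H F [set h])) //.
  by rewrite (hmulSA (Q := F)) // mFF -hmulSA // mFF.
by rewrite {1}/dcoset !hmulSS // sub1set.
Qed.

Lemma dcoset_eq x h : h \in car H -> x \in dcoset H F h ->
  dcoset H F x = dcoset H F h.
Proof.
move=> Hh xh; have Hx := subsetP (dcoset_sub Hh) x xh.
by apply/eqP; rewrite eqEsubset !dcosetS // dcoset_sym.
Qed.

Lemma dcoset1 : dcoset H F (hone H) = F.
Proof.
rewrite /dcoset (_ : hmulS H F _ = F) ?mFF //.
apply/setP=> x; apply/hmulSP/idP => [[f [y [Ff /set1P->]]]|Fx].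
  by rewrite (hmulr1 hypH) ?inF // inE => /eqP->.
by exists x, (hone H); rewrite (hmulr1 hypH) ?inF ?inE.
Qed.

Let pFq p q := hmulS H (hmulS H [set p] F) [set q].

Let hmul_quot_aux a b x : a \in car H -> b \in car H ->
  x \in hmulS H (dcoset H F a) (dcoset H F b) ->
  exists2 y, y \in pFq a b & dcoset H F x = dcoset H F y.
Proof.
move=> Ha Hb.
have a1 : [set a] \subset car H by rewrite sub1set.
have b1 : [set b] \subset car H by rewrite sub1set.
have aF : hmulS H [set a] F \subset car H by rewrite hmulS_sub.
have Fb : hmulS H F [set b] \subset car H by rewrite hmulS_sub.
have aFb : pFq a b \subset car H by rewrite hmulS_sub.
have -> : hmulS H (dcoset H F a) (dcoset H F b)
  = hmulS H (hmulS H F (pFq a b)) F.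
  rewrite /dcoset /pFq hmulSA ?hmulS_sub //.
  rewrite (hmulSA (Q := F)) ?hmulS_sub //.
  rewrite -(hmulSA (P := hmulS H F [set a])) ?mFF ?hmulS_sub //.
  by rewrite !hmulSA ?hmulS_sub.
move=> /hmulSP[z [g [/hmulSP[f [y [Ff yab zfy]]] Fg xzg]]].
exists y => //; apply: dcoset_eq; first exact: subsetP yab.
by apply/dcosetP; exists f, g, z.
Qed.

Lemma hmul_quot a b : a \in car H -> b \in car H ->
  hmul (hquot H F) (dcoset H F a) (dcoset H F b)
  = [set dcoset H F x | x in hmulS H (hmulS H [set a] F) [set b]].
Proof.
move=> Ha Hb; apply/setP=> X; apply/bigcupP/idP => /=.
  move=> [a' /andP[Ha' /eqP ea] /bigcupP[b' /andP[Hb' /eqP eb]]].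
  move=> /imsetP[x xab ->].
  have: x \in hmulS H (dcoset H F a) (dcoset H F b).
    move: xab; apply/subsetP/hmulSS.
      by rewrite -ea /dcoset hmulSS // hmulS1s // sub1set.
    by rewrite sub1set -eb dcoset_refl.
  by move=> /(hmul_quot_aux Ha Hb)[y yab ->]; apply: imset_f.
move=> abX; exists a; first by rewrite Ha eqxx.
by apply/bigcupP; exists b; first by rewrite Hb eqxx.
Qed.

Lemma hinv_quot a : a \in car H ->
  hinv (hquot H F) (dcoset H F a) = dcoset H F (hinv H a).
Proof.
move=> Ha; apply/setP=> x; apply/bigcupP/idP => /= [[a' /andP[Ha' /eqP ea]]|ax].
  rewrite (@dcoset_eq (hinv H a') (hinv H a)) ?(hinv_in hypH) //.
  have /dcosetP[f [g [y [Ff Fg yfa a'yg]]]] : a' \in dcoset H F a.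
    by rewrite -ea dcoset_refl.
  have Hy := subsetP (hmul_sub hypH (inF Ff) Ha) y yfa.
  have Ha1 : [set hinv H a] \subset car H by rewrite sub1set (hinv_in hypH).
  rewrite /dcoset -hmulSA //.
  apply: hmulS_mem (hinv_hmul Hy (inF Fg) a'yg); first exact: hclosedV.
  by apply: hmulS_mem (hinv_hmul (inF Ff) Ha yfa); rewrite ?inE ?hclosedV.
by exists a; rewrite ?Ha ?eqxx.
Qed.

Let mem_quot a b x : a \in car H -> b \in car H ->
  x \in hmulS H (dcoset H F a) (dcoset H F b) ->
  dcoset H F x \in hmul (hquot H F) (dcoset H F a) (dcoset H F b).
Proof.
move=> Ha Hb /(hmul_quot_aux Ha Hb)[y yab ->].
by rewrite hmul_quot //; apply: imset_f.
Qed.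

Lemma hypergroup_quot : hypergroup (hquot H F).
Proof.
have H1 := hone_in hypH.
have s1 a : a \in car H -> [set a] \subset car H by rewrite sub1set.
split=> /=.
- by apply/imsetP; exists (hone H); rewrite ?dcoset1.
- move=> _ /imsetP[a Ha ->]; have := hinv_quot Ha; rewrite /= => ->.
  by apply/imset_f/(hinv_in hypH).
- move=> _ _ /imsetP[a Ha ->] /imsetP[b Hb ->].
  have := hmul_quot Ha Hb; rewrite /= => ->.
  by apply/imsetS/hmulS_sub; rewrite ?hmulS_sub ?s1.
- move=> _ _ _ /imsetP[a Ha ->] /imsetP[b Hb ->] /imsetP[c Hc ->].
  set A := dcoset H F a; set B := dcoset H F b; set C := dcoset H F c.
  have [a1 b1 c1] := And3 (s1 _ Ha) (s1 _ Hb) (s1 _ Hc).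
  have abH : pFq a b \subset car H by rewrite !hmulS_sub.
  have bcH : pFq b c \subset car H by rewrite !hmulS_sub.
  have eA : hmulS H (hmulS H [set a] F) (pFq b c)
    = hmulS H (hmulS H (pFq a b) F) [set c].
    by rewrite /pFq !hmulSA ?hmulS_sub.
  transitivity
    ([set dcoset H F x | x in hmulS H (hmulS H [set a] F) (pFq b c)]); last first.
    rewrite eA; apply/setP=> X; apply/imsetP/bigcupP.
      move=> [x /hmulSP[z [c' [/hmulSP[y [f [yab Ff zyf]]] cc xzc]]] ->].
      exists (dcoset H F y).
        by have := hmul_quot Ha Hb; rewrite /= => ->; apply: imset_f.
      have Hy := subsetP abH y yab.
      rewrite big_set1; have := hmul_quot Hy Hc; rewrite /= => ->.
      apply: imset_f; apply: (hmulS_mem _ cc xzc).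
      by apply: hmulS_mem zyf; rewrite ?inE.
    move=> [Y]; have := hmul_quot Ha Hb; rewrite /= => -> /imsetP[y yab ->].
    have Hy := subsetP abH y yab.
    rewrite big_set1; have := hmul_quot Hy Hc; rewrite /= => -> /imsetP[x xyc ->].
    exists x => //; move: xyc; apply/subsetP; rewrite !hmulSS // sub1set //.
  apply/setP=> X; apply/bigcupP/imsetP.
    move=> [_ /set1P-> /bigcupP[Y]].
    have := hmul_quot Hb Hc; rewrite /= => -> /imsetP[y ybc ->].
    have Hy := subsetP bcH y ybc.
    have := hmul_quot Ha Hy; rewrite /= => -> /imsetP[x xay ->].
    by exists x => //; move: xay; apply/subsetP; rewrite !hmulSS // sub1set.
  move=> [x /hmulSP[z [y [zaF ybc xzy]]] ->]; exists A; first by rewrite inE.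
  have Hy := subsetP bcH y ybc.
  apply/bigcupP; exists (dcoset H F y).
    by have := hmul_quot Hb Hc; rewrite /= => ->; apply: imset_f.
  have := hmul_quot Ha Hy; rewrite /= => ->.
  by apply: imset_f; apply: (hmulS_mem zaF (set11 _) xzy).
- move=> _ /imsetP[a Ha ->].
  have /= := hmul_quot Ha H1; rewrite dcoset1 => ->.
  have -> : hmulS H (hmulS H [set a] F) [set hone H] = hmulS H [set a] F.
    rewrite -hmulSA ?s1 //; congr (hmulS H _ _).
    apply/setP=> x; apply/hmulSP/idP => [[f [y [Ff /set1P->]]]|Fx].
      by rewrite (hmulr1 hypH) ?inF // inE => /eqP->.
    by exists x, (hone H); rewrite (hmulr1 hypH) ?inF ?inE.
  apply/setP=> X; rewrite inE; apply/imsetP/eqP => [[x xa ->]|->].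
    apply: dcoset_eq => //; move: xa; apply/subsetP.
    by rewrite hmulSS // hmulS1s // s1.
  exists a => //; apply/(hmulS_mem (q := hone H)); rewrite ?inE ?hclosed1 //.
  by rewrite (hmulr1 hypH) ?inE.
move=> _ _ X /imsetP[a Ha ->] /imsetP[b Hb ->] _.
have /= -> := hmul_quot Ha Hb; move=> /imsetP[x xab ->{X}].
have [a1 b1] := (s1 _ Ha, s1 _ Hb).
have Hx : x \in car H by apply: subsetP xab; rewrite !hmulS_sub.
have [Ha' Hb'] := (hinv_in hypH Ha, hinv_in hypH Hb).
have /= -> := hinv_quot Ha; have /= -> := hinv_quot Hb.
have /hmulSP[y [_ [/hmulSP[_ [f [/set1P-> Ff yaf]]] /set1P-> xyb]]] := xab.
have Hy := subsetP (hmul_sub hypH Ha (inF Ff)) y yaf.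
have [bxy yxb] := hmul_exch hypH Hy Hb Hx xyb.
have [_ ayf] := hmul_exch hypH Ha (inF Ff) Hy yaf.
split; apply: mem_quot => //.
  apply: (hmulS_mem _ (dcoset_refl Hx) bxy).
  rewrite /dcoset -hmulSA ?s1 //.
  apply: hmulS_mem (hinv_hmul Ha (inF Ff) yaf); first exact: hclosedV.
  by apply: (subsetP (hmulSs1 (s1 _ Ha'))); rewrite inE.
have: a \in hmulS H (hmulS H [set x] [set hinv H b]) F.
  by rewrite hmulS11; apply: (hmulS_mem yxb _ ayf); apply: hclosedV.
rewrite -hmulSA ?s1 //; apply/subsetP/hmulSS; first by rewrite sub1set dcoset_refl.
by rewrite /dcoset -hmulSA ?s1 // hmulS1s // hmulS_sub ?s1.
Qed.

End QuotientFacts.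

Lemma valency_gt0 (T : finType) (H : hyperstruct T) :
  residually_thin H <-> 0 < valency H.
Proof.
have card_path: forall A s, path (rt_step H) A s -> #|A| + size s <= #|last A s|.
  move=> A s; elim: s A => [|B s IHs] A /=; first by rewrite addn0.
  move=> /andP[/and4P[_ _ /proper_card ltAB _] /IHs]; apply: leq_trans.
  by rewrite addnS -addSn leq_add2r.
rewrite /valency; case: pickP => [s s_chain | no_chain]; split=> //.
- move=> _; rewrite /chain_valency.
  have /andP[+ _] := s_chain; elim: (bseqval s) [set hone H] => [|B r IHr] A /=.
    by rewrite big_nil.
  move=> /andP[/and4P[_ /and3P[_ /set0Pn[b Bb] _] _ _] /IHr r_gt0].
  rewrite big_cons muln_gt0 r_gt0 andbT /=.
  by apply/card_gt0P; exists (dcoset (subhyper H B) A b); apply: imset_f.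
- by exists (bseqval s).
move=> [s s_chain]; have /andP[s_path _] := s_chain.
have le_s : size s <= #|T|.
  by apply: leq_trans (max_card _); apply: leq_trans (card_path _ _ s_path); apply: leq_addl.
by have := no_chain (Bseq le_s); rewrite s_chain.
Qed.

(* Main.v *)
Require Import Defs.
From mathcomp Require Import all_boot all_fingroup cyclic.
From mathcomp Require pgroup.

Set Implicit Arguments.
Unset Strict Implicit.
Unset Printing Implicit Defensive.

(** The valency of a closed subset behaves like the order of a subgroup: it is
    the product of the indices along any chain with thin quotients, and it
    divides the valency of any larger closed subset.  This follows from one
    counting fact, the multiplicativity of the number of left cosets below a
    strongly normal subset.

    Given this, let [N] be maximal among the normal closed subsets of [H] inside
    the Sylow subset [P].  Its valency divides that of [P], so it is a power of
    [p], and the hypothesis that [H] is [p]-valenced applies to [U = N]: in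
    [K = H//N], whenever [h^* h] is made of thin elements, [#|h^* h|] is a power
    of [p].  The upper central series of [H] maps onto a central series
    [W_0, W_1, ..., W_n = K] of [K].

    The key step ([central_series_dichotomy]) is that either [K] has a central
    closed subset of order [p], or [K] is a group of order prime to [p].
    Suppose that [W_0, ..., W_i] are groups of order prime to [p].  For [h] in
    [W_(i+1)] the set [h^* h] lies in [W_i] and is there the stabiliser of [h]
    under right multiplication.  Its order is a power of [p] dividing
    [#|W_i|], so it is trivial and [h] is thin: [W_(i+1)] is a group.  If [p]
    divides its order, Cauchy's theorem gives [h] of order [p].  Left
    multiplication by [h] of an [x] that commutes with it modulo a [W_j]
    centralised by [h] yields [h x = x h z] with [z] in [W_j], whence
    [x = h^p x = x z^p].  As [z] has order prime to [p], [z] fixes [x], and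
    [h x = x h].  Applied along [j = 0, 1, ..., i], this shows that [h]
    centralises every [W_j] and at last all of [K] ([commute_mod_coprime],
    [pelt_commutes]).

    In the first case let [Q] be the preimage in [H] of the central subset of
    order [p]; it is normal in [H].  If [Q] were not inside [P], then [P] would
    have index [p] in the closed subset [QP], so that [p n_P] would divide
    [n_H], against the definition of a Sylow subset; and [Q] inside [P]
    contradicts the maximality of [N].  In the second case the index of [N] in
    [P] is a power of [p] dividing [#|K|], so [P = N], and thinness of [H//N]
    says that [N] is strongly normal in [H]. *)

(** * Elementwise calculus and left cosets *)

Section Basics.

Variables (T : finType) (H : hyperstruct T).
Hypothesis hypH : hypergroup H.
Implicit Types (U F W D N A B : {set T}) (p q r x y z h : T).

Lemma hmul_in p q x :
  p \in car H -> q \in car H -> x \in hmul H p q -> x \in car H.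
Proof. by move=> Hp Hq; apply: subsetP; apply: (hmul_sub hypH). Qed.

Lemma hmul_exchL p q r :
  p \in car H -> q \in car H -> r \in hmul H p q -> q \in hmul H (hinv H p) r.
Proof.
by move=> Hp Hq Hr; have [] := hmul_exch hypH Hp Hq (hmul_in Hp Hq Hr) Hr.
Qed.

Lemma hmul_exchR p q r :
  p \in car H -> q \in car H -> r \in hmul H p q -> p \in hmul H r (hinv H q).
Proof.
by move=> Hp Hq Hr; have [] := hmul_exch hypH Hp Hq (hmul_in Hp Hq Hr) Hr.
Qed.

Lemma hmul_assocl p q r y x : p \in car H -> q \in car H -> r \in car H ->
  y \in hmul H q r -> x \in hmul H p y ->
  exists2 z, z \in hmul H p q & x \in hmul H z r.
Proof.
move=> Hp Hq Hr yqr xpy.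
have: x \in hmulS H [set p] (hmul H q r) by apply: hmulS_mem xpy; rewrite ?inE.
rewrite (hmulA hypH) // => /hmulSP[z [r' [zpq /set1P-> xzr]]].
by exists z.
Qed.

Lemma hmul_assocr p q r z x : p \in car H -> q \in car H -> r \in car H ->
  z \in hmul H p q -> x \in hmul H z r ->
  exists2 y, y \in hmul H q r & x \in hmul H p y.
Proof.
move=> Hp Hq Hr zpq xzr.
have: x \in hmulS H (hmul H p q) [set r] by apply: hmulS_mem xzr; rewrite ?inE.
rewrite -(hmulA hypH) // => /hmulSP[p' [y [/set1P-> yqr xpy]]].
by exists y.
Qed.

(** The element [q] lies in [1 q], hence in [(p^* p) q = p^* (p q)]. *)
Lemma hmul_nonempty p q : p \in car H -> q \in car H ->
  exists r, r \in hmul H p q.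
Proof.
move=> Hp Hq; have q1: q \in hmul H (hone H) q by rewrite hmul1s ?inE.
have [y ypq _] := hmul_assocr (hinv_in hypH Hp) Hp Hq (hone_hmulVs hypH Hp) q1.
by exists y.
Qed.

Lemma hclosed_sub F x : hclosed H F -> x \in F -> x \in car H.
Proof. by case/and3P=> /subsetP sF _ _; apply: sF. Qed.

Lemma hclosedVM F x y z : hclosed H F -> x \in F -> y \in F ->
  z \in hmul H (hinv H x) y -> z \in F.
Proof.
by move=> cF Fx Fy; apply: (hclosedM hypH cF) => //; apply: (hclosedV hypH cF).
Qed.

Lemma hclosedI F D : hclosed H F -> hclosed H D -> hclosed H (F :&: D).
Proof.
move=> cF cD; apply/and3P; split.
- by have /and3P[sF _ _] := cF; rewrite subIset ?sF.
- by apply/set0Pn; exists (hone H); rewrite inE !hclosed1.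
apply/subsetP=> x /hmulSP[_ [q [/imsetP[p /setIP[Fp Dp] ->]]]].
move=> /setIP[Fq Dq] xpq.
by rewrite inE (hclosedVM cF Fp Fq) ?(hclosedVM cD Dp Dq).
Qed.

Lemma hclosed_one : hclosed H [set hone H].
Proof.
apply/and3P; split; first by rewrite sub1set (hone_in hypH).
  by apply/set0Pn; exists (hone H); rewrite inE.
apply/subsetP=> x /hmulSP[_ [_ [/imsetP[_ /set1P-> ->] /set1P-> ]]].
by rewrite hinv1 // (hmulr1 hypH) // (hone_in hypH).
Qed.

Lemma hclosed_car : hclosed H (car H).
Proof.
apply/and3P; split=> //; first by apply/set0Pn; exists (hone H); apply: hone_in.
apply/subsetP=> x /hmulSP[_ [q [/imsetP[p Hp ->] Hq]]].
by apply: hmul_in; rewrite ?(hinv_in hypH).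
Qed.

Definition lcos U h : {set T} := hmulS H [set h] U.

Lemma lcosP U h x :
  reflect (exists2 u, u \in U & x \in hmul H h u) (x \in lcos U h).
Proof.
apply: (iffP (hmulSP _ _ _ _)) => [[_ [u [/set1P-> Uu xhu]]]|[u Uu xhu]].
  by exists u.
by exists h, u; rewrite inE eqxx.
Qed.

Lemma lcos_refl U h : hclosed H U -> h \in car H -> h \in lcos U h.
Proof.
move=> cU Hh; apply/lcosP; exists (hone H); first exact: hclosed1 hypH _ cU.
by rewrite (hmulr1 hypH) ?inE.
Qed.

Lemma lcos_in U h x : hclosed H U -> h \in car H ->
  x \in lcos U h -> x \in car H.
Proof.
by move=> cU Hh /lcosP[u Uu]; apply: hmul_in => //; apply: hclosed_sub cU Uu.
Qed.

Lemma lcos_sym U h x : hclosed H U -> h \in car H ->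
  x \in lcos U h -> h \in lcos U x.
Proof.
move=> cU Hh /lcosP[u Uu xhu]; apply/lcosP; exists (hinv H u).
  exact: (hclosedV hypH cU).
by apply: hmul_exchR => //; apply: hclosed_sub Uu.
Qed.

Lemma lcos_trans U h x y : hclosed H U -> h \in car H ->
  x \in lcos U h -> y \in lcos U x -> y \in lcos U h.
Proof.
move=> cU Hh /lcosP[u Uu xhu] /lcosP[v Uv yxv]; apply/lcosP.
have [w wuv yhw] := hmul_assocr Hh (hclosed_sub cU Uu) (hclosed_sub cU Uv) xhu yxv.
by exists w => //; apply: (hclosedM hypH cU) wuv.
Qed.

Lemma lcos_eq U h x : hclosed H U -> h \in car H ->
  x \in lcos U h -> lcos U x = lcos U h.
Proof.
move=> cU Hh xh; have Hx := lcos_in cU Hh xh; apply/setP=> y; apply/idP/idP.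
  exact: lcos_trans.
by apply: lcos_trans => //; apply: lcos_sym.
Qed.

Lemma lcos_closed U F h : hclosed H F -> U \subset F -> h \in F ->
  lcos U h \subset F.
Proof.
move=> cF /subsetP sUF Fh; apply/subsetP=> x /lcosP[u /sUF Fu].
exact: hclosedM.
Qed.

Lemma lcos_mull U W h : hclosed H U -> hclosed H W -> U \subset W ->
  h \in car H -> hmulS H (lcos U h) W = lcos W h.
Proof.
move=> cU cW sUW Hh.
rewrite /lcos -(hmulSA hypH) ?sub1set //; last by case/and3P: cW.
  congr (hmulS H _ _); apply/eqP; rewrite eqEsubset (hmulS1s hypH cU) ?andbT.
    apply/subsetP=> x /hmulSP[u [w [/(subsetP sUW) Uu Ww]]].
    exact: (hclosedM hypH cW).
  by case/and3P: cW.
by case/and3P: cU.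
Qed.

(** The order of [F//U] when [U] is strongly normal in [F]; defined for all
    closed [U] so that it also counts cosets of subsets that are not normal. *)
Definition lcos_index U F := #|[set lcos U h | h in F]|.

Definition normalizes F U : Prop := forall u f y,
  u \in U -> f \in F -> y \in hmul H u f -> y \in lcos U f.

(** Strong normality of [U] in [F], split into normality and [f^* f <= U].  The
    two together are equivalent to [f^* U f <= U], see [snormalP], and are what
    coset computations use. *)
Definition snormal U F : Prop :=
  [/\ hclosed H U, hclosed H F, U \subset F & normalizes F U]
  /\ forall f y, f \in F -> y \in hmul H (hinv H f) f -> y \in U.

(** From [f^* U f <= U]: an element of [u f] lies in [f (f^* u f)], because [1]
    lies in [f f^*]; conversely [f^* u f <= (f^* f) U]. *)
Lemma snormalP U F : hclosed H F ->
  reflect (snormal U F) (strongly_normal (subhyper H F) U).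
Proof.
move=> cF; apply: (iffP andP) => /=.
  case=> /and3P[/= sUF U0 UU] /'forall_implyP/= snU.
  have cU : hclosed H U.
    by rewrite /hclosed U0 UU (subset_trans sUF) //; case/and3P: cF.
  have vU f u x y : f \in F -> u \in U -> x \in hmul H (hinv H f) u ->
      y \in hmul H x f -> y \in U.
    move=> Ff Uu xfu yxf; apply: (subsetP (snU f Ff)).
    apply: (@hmulS_mem _ (subhyper H F)) yxf; last by rewrite inE.
    by apply: (@hmulS_mem _ (subhyper H F)) xfu; rewrite ?inE.
  split; first split=> //.
    move=> u f y Uu Ff yuf; have Hu := hclosed_sub cU Uu.
    have Hf := hclosed_sub cF Ff; have Hf' := hinv_in hypH Hf.
    have Hy := hmul_in Hu Hf yuf.
    have ffy : hone H \in hmul H f (hinv H f).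
      by rewrite -{1}(hinvK hypH Hf); apply: hone_hmulVs.
    have [|w wfy yfw] := hmul_assocr Hf Hf' Hy ffy (x := y).
      by rewrite hmul1s ?inE.
    apply/lcosP; exists w => //.
    have [x xfu] := hmul_assocl Hf' Hu Hf yuf wfy.
    exact: (vU f u x).
  move=> f y Ff; have Hf := hclosed_sub cF Ff.
  apply: (vU f (hone H) (hinv H f)) => //; first exact: (hclosed1 hypH cU).
  by rewrite (hmulr1 hypH) ?inE // (hinv_in hypH).
case=> [[cU _ sUF nU] vU]; split.
  by have /and3P[_ U0 UU] := cU; apply/and3P; split.
apply/'forall_implyP => /= f Ff; apply/subsetP=> y.
move=> /hmulSP[x [_ [/hmulSP[_ [u [/set1P-> Uu xfu]]] /set1P-> /= yxf]]].
have [Hf Hu] := (hclosed_sub cF Ff, hclosed_sub cU Uu).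
have [w wuf yfw] := hmul_assocr (hinv_in hypH Hf) Hu Hf xfu yxf.
have /lcosP[v Uv wfv] := nU u f w Uu Ff wuf.
have [z zff yzv] := hmul_assocl (hinv_in hypH Hf) Hf (hclosed_sub cU Uv) wfv yfw.
by apply: (hclosedM hypH cU) yzv => //; apply: vU zff.
Qed.

Lemma snormal_sub U F D :
  snormal U F -> hclosed H D -> D \subset F -> snormal (U :&: D) D.
Proof.
move=> [[cU cF sUF nU] vU] cD /subsetP sDF; split; first split=> //.
- exact: hclosedI.
- exact: subsetIr.
- move=> u f y /setIP[Uu Du] Df yuf.
  have /lcosP[v Uv yfv] := nU u f y Uu (sDF f Df) yuf.
  apply/lcosP; exists v; rewrite // inE Uv /=.
  have Dy := hclosedM hypH cD Du Df yuf.
  apply: (hclosedVM cD Df Dy).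
  by apply: hmul_exchL yfv; rewrite ?(hclosed_sub cD Df) ?(hclosed_sub cU Uv).
move=> f y Df yff; rewrite inE (vU f) ?sDF //=.
exact: hclosedVM yff.
Qed.

(** Since [h] is in [a w^* ], [b] is in [a (w^* w)], and [w^* w <= U]. *)
Lemma snormal_mul_lcos U F h w a b : snormal U F -> h \in F -> w \in F ->
  a \in hmul H h w -> b \in hmul H h w -> b \in lcos U a.
Proof.
move=> [[cU cF sUF nU] vU] Fh Fw ahw bhw.
have [Hh Hw] := (hclosed_sub cF Fh, hclosed_sub cF Fw).
have Ha := hmul_in Hh Hw ahw.
have [z zww baz] := hmul_assocr Ha (hinv_in hypH Hw) Hw (hmul_exchR Hh Hw ahw) bhw.
by apply/lcosP; exists z => //; apply: vU zww.
Qed.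

Lemma lcos_mulr U F h w y : snormal U F -> h \in F -> w \in F ->
  y \in hmul H h w -> hmulS H [set h] (lcos U w) = lcos U y.
Proof.
move=> snU Fh Fw yhw; have [[cU cF sUF nU] vU] := snU.
have [Hh Hw] := (hclosed_sub cF Fh, hclosed_sub cF Fw).
have Hy := hmul_in Hh Hw yhw.
rewrite /lcos (hmulSA hypH) ?sub1set //; last by case/and3P: cU.
rewrite hmulS11; apply/setP=> x; apply/idP/idP => [|xy].
  move=> /hmulSP[z [u [zhw Uu xzu]]].
  apply: (lcos_trans (x := z)) => //; first exact: (snormal_mul_lcos snU Fh Fw).
  by apply/lcosP; exists u.
by apply: subsetP xy; rewrite hmulSS // sub1set.
Qed.

(** The cosets of [U] inside a given coset [h W] are the sets [h w U] with [w] in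
    [W].  Since [U] is strongly normal each of these is a single coset, so left
    multiplication by [h] matches them with the cosets of [U] in [W].
    With [W] any closed subset in between, this is also Lagrange's theorem in the
    group [F//U]. *)
Lemma lcos_index_tower U W F : snormal U F -> hclosed H W -> U \subset W ->
  W \subset F -> lcos_index U F = lcos_index W F * lcos_index U W.
Proof.
move=> snU cW sUW sWF; have [[cU cF sUF nU] vU] := snU.
have HF x : x \in F -> x \in car H by apply: hclosed_sub.
have inW x : x \in W -> x \in F by apply: subsetP.
rewrite [LHS]/lcos_index -sum1_card.
pose f A := hmulS H A W.
rewrite (partition_big f (mem [set lcos W h | h in F])) /=; last first.
  move=> _ /imsetP[h Fh ->]; rewrite /f lcos_mull // ?HF //.
  exact: imset_f.
rewrite (eq_bigr (fun=> lcos_index U W)) ?sum_nat_const //.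
move=> _ /imsetP[h Fh ->].
have Hh := HF h Fh.
(* the fibre over the coset hW *)
transitivity #|[set hmulS H [set h] A | A in [set lcos U w | w in W]]|.
  rewrite sum1_card; apply: eq_card => A; rewrite /=.
  apply/andP/imsetP => [[/imsetP[x Fx ->]]|[_ /imsetP[w Ww ->] ->]].
    rewrite /f lcos_mull ?HF // => /eqP exh.
    have: x \in lcos W h by rewrite -exh lcos_refl ?HF.
    move=> /lcosP[w Ww xhw]; exists (lcos U w); first exact: imset_f.
    by rewrite (lcos_mulr (F := F) (y := x)) // inW.
  have [y yhw] := hmul_nonempty Hh (HF w (inW w Ww)).
  have Fy : y \in F by exact: (hclosedM hypH cF Fh (inW w Ww) yhw).
  rewrite (lcos_mulr (F := F) snU Fh (inW w Ww) yhw); split.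
    exact: imset_f.
  rewrite /f lcos_mull ?HF //; apply/eqP/lcos_eq => //.
  by apply/lcosP; exists w.
rewrite card_in_imset // => _ _ /imsetP[w Ww ->] /imsetP[w' Ww' ->].
have [Fw Fw'] := (inW w Ww, inW w' Ww').
have [y yhw] := hmul_nonempty Hh (HF w Fw).
have [y' yhw'] := hmul_nonempty Hh (HF w' Fw').
rewrite (lcos_mulr snU Fh Fw yhw) (lcos_mulr snU Fh Fw' yhw') => eyy.
have Hy := hmul_in Hh (HF w Fw) yhw; have Hy' := hmul_in Hh (HF w' Fw') yhw'.
have: y' \in lcos U y by rewrite eyy lcos_refl.
move=> /lcosP[u Uu y'yu].
have [z zwu yhz] := hmul_assocr Hh (HF w Fw) (hclosed_sub cU Uu) yhw y'yu.
have Fz : z \in F by apply: (hclosedM hypH cF) zwu => //; apply: subsetP Uu.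
have zw : z \in lcos U w by apply/lcosP; exists u.
rewrite -(lcos_eq cU (HF w Fw) zw); apply/esym/lcos_eq; rewrite ?HF //.
apply: (snormal_mul_lcos (F := F) (h := hinv H h) (w := y')) => //.
- exact: (hclosedV hypH cF).
- exact: (hclosedM hypH cF Fh Fw' yhw').
- by apply: hmul_exchL; rewrite ?HF.
by apply: hmul_exchL; rewrite ?HF.
Qed.

Lemma lcos_index_id F : hclosed H F -> lcos_index F F = 1.
Proof.
move=> cF; apply/eqP/cards1P; exists F.
have F1 := hclosed1 hypH cF.
have eF h : h \in F -> lcos F h = F.
  move=> Fh; apply/eqP; rewrite eqEsubset lcos_closed //=.
  apply/subsetP=> x Fx; have [Hx Hh] := (hclosed_sub cF Fx, hclosed_sub cF Fh).
  have [||z zhx xhz] := hmul_assocr Hh (hinv_in hypH Hh) Hx (z := hone H) (x := x).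
  - by rewrite -{1}(hinvK hypH Hh); apply/hone_hmulVs/hinv_in.
  - by rewrite hmul1s ?inE.
  by apply/lcosP; exists z => //; apply: hclosedVM zhx.
apply/setP=> A; rewrite inE; apply/imsetP/eqP => [[h Fh ->]|->].
  exact: eF.
by exists (hone H); rewrite ?eF.
Qed.

Lemma lcos_index_eq1 U F :
  hclosed H U -> hclosed H F -> U \subset F ->
  lcos_index U F = 1 -> F \subset U.
Proof.
move=> cU cF sUF /eqP/cards1P[A eA]; apply/subsetP=> f Ff.
have [Hf H1] := (hclosed_sub cF Ff, hone_in hypH).
have := imset_f (lcos U) Ff; rewrite eA => /set1P ef.
have := imset_f (lcos U) (hclosed1 hypH cF); rewrite eA -ef => /set1P e1.
have : f \in lcos U (hone H) by rewrite e1 lcos_refl.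
by case/lcosP=> u Uu; rewrite hmul1s ?(hclosed_sub cU Uu) // => /set1P->.
Qed.

Lemma hclosed_mul D U : hclosed H D -> hclosed H U -> normalizes D U ->
  hclosed H (hmulS H D U).
Proof.
move=> cD cU nU; have HD := hclosed_sub cD; have HU := hclosed_sub cU.
apply/and3P; split.
- by apply: (hmulS_sub hypH); [case/and3P: cD | case/and3P: cU].
- apply/set0Pn; exists (hone H); apply: (subsetP (hmulS1s hypH cD _)).
    by case/and3P: cU.
  exact: (hclosed1 hypH cU).
apply/subsetP=> z /hmulSP[_ [y [/imsetP[x DUx ->] + zxy]]].
move=> /hmulSP[d' [u' [Dd' Uu' yd'u']]].
have /hmulSP[d [u [Dd Uu xdu]]] := DUx.
have [[Hd Hu] [Hd' Hu']] := ((HD d Dd, HU u Uu), (HD d' Dd', HU u' Uu')).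
have Hx := hmul_in Hd Hu xdu.
have x'ud := hinv_hmul hypH Hd Hu xdu.
have [v vxd zvu] := hmul_assocl (hinv_in hypH Hx) Hd' Hu' yd'u' zxy.
have [e edd vue] := hmul_assocr (hinv_in hypH Hu) (hinv_in hypH Hd) Hd' x'ud vxd.
have De := hclosedVM cD Dd Dd' edd.
have /lcosP[t Ut vet] := nU _ _ _ (hclosedV hypH cU Uu) De vue.
have [w wtu zew] := hmul_assocr (HD e De) (HU t Ut) Hu' vet zvu.
by apply: hmulS_mem zew => //; apply: (hclosedM hypH cU) wtu.
Qed.

(** [U] absorbs its own factor of [D U], so strong normality in [D U] needs to be
    checked against [D] only. *)
Lemma snormal_mul_closed D U :
  hclosed H D -> hclosed H U -> normalizes D U ->
  (forall d y, d \in D -> y \in hmul H (hinv H d) d -> y \in U) ->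
  snormal U (hmulS H D U).
Proof.
move=> cD cU nU vU; have cDU := hclosed_mul cD cU nU.
have HD := hclosed_sub cD; have HU := hclosed_sub cU.
split; first split=> //.
- by apply: (hmulS1s hypH cD); case/and3P: cU.
- move=> u f y Uu /hmulSP[d [v [Dd Uv fdv]]] yuf.
  have [e eud yev] := hmul_assocl (HU u Uu) (HD d Dd) (HU v Uv) fdv yuf.
  rewrite (@lcos_eq U d f) ?HD //; last by apply/lcosP; exists v.
  apply: (lcos_trans cU (HD d Dd) (nU u d e Uu Dd eud)).
  by apply/lcosP; exists v.
move=> f y /hmulSP[d [v [Dd Uv fdv]]] yff.
have [Hd Hv] := (HD d Dd, HU v Uv); have Hf := hmul_in Hd Hv fdv.
have [Hd' Hv'] := (hinv_in hypH Hd, hinv_in hypH Hv).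
have [z zfd yzv] := hmul_assocl (hinv_in hypH Hf) Hd Hv fdv yff.
have [t tdd zvt] := hmul_assocr Hv' Hd' Hd (hinv_hmul hypH Hd Hv fdv) zfd.
apply: (hclosedM hypH cU _ Uv yzv).
exact: (hclosedVM cU Uv (vU d t Dd tdd)).
Qed.

(** The second isomorphism theorem, read on coset counts. *)
Lemma lcos_index_mul D U F : snormal U F -> hclosed H D -> D \subset F ->
  lcos_index (U :&: D) D = lcos_index U (hmulS H D U).
Proof.
move=> [[cU cF sUF nU] vU] cD sDF; have HD := hclosed_sub cD.
have cUD := hclosedI cU cD.
have eU d : d \in D -> hmulS H (lcos (U :&: D) d) U = lcos U d.
  by move=> Dd; rewrite lcos_mull ?subsetIl ?HD.
transitivity #|[set hmulS H A U | A in [set lcos (U :&: D) d | d in D]]|.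
  rewrite card_in_imset // => _ _ /imsetP[d Dd ->] /imsetP[e De ->].
  rewrite !eU // => ede; have [Hd He] := (HD d Dd, HD e De).
  have: e \in lcos U d by rewrite ede lcos_refl.
  move=> /lcosP[u Uu edu]; apply/esym/lcos_eq => //.
  apply/lcosP; exists u => //; rewrite inE Uu.
  apply: (hclosedVM cD Dd De).
  by apply: hmul_exchL edu; rewrite ?(hclosed_sub cU Uu).
apply: eq_card => A; apply/imsetP/imsetP=> [[_ /imsetP[d Dd ->] ->]|].
  exists d; last by rewrite eU.
  apply: (subsetP (hmulSs1 hypH cU _)) => //; by case/and3P: cD.
move=> [x /hmulSP[d [u [Dd Uu xdu]]] ->].
exists (lcos (U :&: D) d); first exact: imset_f.
by rewrite eU //; apply: lcos_eq; rewrite ?HD //; apply/lcosP; exists u.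
Qed.

Lemma lcos_index_sub_dvd D U F : snormal U F -> hclosed H D -> D \subset F ->
  lcos_index (U :&: D) D %| lcos_index U F.
Proof.
move=> snU cD sDF; have [[cU cF sUF nU] vU] := snU.
rewrite (lcos_index_mul snU) // (@lcos_index_tower U (hmulS H D U) F) //.
- exact: dvdn_mull.
- apply: hclosed_mul => // u f y Uu Df; apply: nU => //; exact: subsetP Df.
- by apply: (hmulS1s hypH cD); case/and3P: cU.
by apply/subsetP=> x /hmulSP[d [u [/(subsetP sDF) Fd /(subsetP sUF) Fu]]];
  apply: (hclosedM hypH cF).
Qed.

Lemma snormalW U V F : snormal U F -> hclosed H V -> U \subset V ->
  V \subset F -> snormal U V.
Proof.
by move=> snU cV /setIidPl <- sVF; apply: snormal_sub sVF.
Qed.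

(** * Valency *)

(** Chains with possibly repeated terms, which makes this relation stable under
    intersecting a chain with a closed subset. *)
Inductive has_valency : {set T} -> nat -> Prop :=
| has_valency_one : has_valency [set hone H] 1
| has_valency_step U F n :
    has_valency U n -> snormal U F -> has_valency F (n * lcos_index U F).

Lemma hclosed_subone F :
  hclosed H F -> F \subset [set hone H] -> F = [set hone H].
Proof.
by move=> cF sF; apply/eqP; rewrite eqEsubset sF sub1set; apply: hclosed1.
Qed.

Lemma snormalI U V F : snormal U F -> snormal V F -> snormal (U :&: V) F.
Proof.
move=> [[cU cF sUF nU] vU] [[cV _ sVF nV] vV]; split; first split=> //.
- exact: hclosedI.
- by rewrite subIset ?sUF.
- move=> u f y /setIP[Uu Vu] Ff yuf.
  have /lcosP[v Uv yfv] := nU u f y Uu Ff yuf.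
  have /lcosP[w Vw yfw] := nV u f y Vu Ff yuf.
  have [Hf Hv] := (hclosed_sub cF Ff, hclosed_sub cU Uv).
  have Hw := hclosed_sub cV Vw.
  have Hy := hmul_in Hf Hv yfv.
  apply/lcosP; exists v; rewrite // inE Uv /=.
  (* v and w both lie in f^* y, so v lies in the coset wV *)
  have snV : snormal V F by [].
  have Fy : y \in F by apply: (hclosedM hypH cF Ff _ yfv); apply: subsetP Uv.
  have /lcosP[t Vt vwt] := snormal_mul_lcos snV (hclosedV hypH cF Ff) Fy
    (hmul_exchL Hf Hw yfw) (hmul_exchL Hf Hv yfv).
  exact: hclosedM vwt.
move=> f y Ff yff; by rewrite inE (vU f) ?(vV f).
Qed.

(** Intersect the given chain of [F] with [V].  For the top term [U] of the chain,
    counting the cosets of [U :&: V] in [F] through [U] and through [V] compares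
    the two products. *)
Lemma has_valency_snormal V F n : has_valency F n -> snormal V F ->
  exists2 m, has_valency V m & n = m * lcos_index V F.
Proof.
move=> rtF; elim: rtF V => {F n} [|U F n rtU IH snU] V snV.
  have [[cV c1 sV _] _] := snV; rewrite (hclosed_subone cV sV).
  by exists 1; [apply: has_valency_one | rewrite lcos_index_id].
have [[cU cF sUF _] _] := snU; have [[cV _ sVF _] _] := snV.
have snVU := snormal_sub snV cU sUF; have snUV := snormal_sub snU cV sVF.
have [m rtm ->] := IH _ snVU.
exists (m * lcos_index (U :&: V) V).
  by apply: has_valency_step => //; rewrite setIC.
have snI := snormalI snU snV.
rewrite -!mulnA; congr (m * _); rewrite setIC.
rewrite [RHS]mulnC [LHS]mulnC -!lcos_index_tower ?subsetIl ?subsetIr //.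
Qed.

Lemma has_valency_trivial F n :
  has_valency F n -> F \subset [set hone H] -> n = 1.
Proof.
elim=> {F n} // U F n rtU IH [[cU cF sUF _] _] sF1.
rewrite IH ?(subset_trans sUF) // (hclosed_subone cF sF1).
by rewrite (hclosed_subone cU (subset_trans sUF sF1)) lcos_index_id ?hclosed_one.
Qed.

(** A Jordan-Hoelder argument: both chains can be compared with one that passes
    through the top term of the first. *)
Lemma has_valency_uniq F n m : has_valency F n -> has_valency F m -> n = m.
Proof.
move=> rtF; elim: rtF m => {F n} [|U F n rtU IH snU] m rtm.
  by rewrite (has_valency_trivial rtm).
have [k rtk ->] := has_valency_snormal rtm snU.
by rewrite (IH _ rtk).
Qed.

Lemma has_valency_sub F n D : has_valency F n -> hclosed H D -> D \subset F ->
  exists2 m, has_valency D m & m %| n.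
Proof.
move=> rtF; elim: rtF D => {F n} [|U F n rtU IH snU] D cD sDF.
  by rewrite (hclosed_subone cD sDF); exists 1 => //; apply: has_valency_one.
have [[cU cF sUF _] _] := snU.
have [m rtm dmn] := IH (U :&: D) (hclosedI cU cD) (subsetIl _ _).
exists (m * lcos_index (U :&: D) D); last by rewrite dvdn_mul // lcos_index_sub_dvd.
by apply: has_valency_step => //; apply: snormal_sub sDF.
Qed.


Lemma dcoset_memE U x : hclosed H U -> x \in car H ->
  (dcoset H U x == U) = (x \in U).
Proof.
move=> cU Hx; apply/eqP/idP => [<-|Ux]; first exact: dcoset_refl.
rewrite -[RHS](dcoset1 hypH cU).
by apply: dcoset_eq; rewrite ?dcoset1 // hone_in.
Qed.

Lemma dcoset_lcos U x : hclosed H U -> normalizes (car H) U -> x \in car H ->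
  dcoset H U x = lcos U x.
Proof.
move=> cU nU Hx; apply/eqP; rewrite eqEsubset; apply/andP; split.
  apply/subsetP=> y /dcosetP[f [g [z [Uf Ug zfx yzg]]]].
  by apply: (lcos_trans cU Hx (nU f x z Uf Hx zfx)); apply/lcosP; exists g.
by rewrite /dcoset hmulSS // hmulS1s // sub1set.
Qed.

(** Thinness of [H//U] says that [h^* U h] consists of elements whose class is
    [U]. *)
Lemma thin_quotP U : hclosed H U ->
  reflect (snormal U (car H)) (thin (hquot H U)).
Proof.
move=> cU; apply: (iffP idP) => [/eqP eH | snU].
  apply/snormalP; first exact: hclosed_car.
  apply/andP; split; first by have /and3P[] := cU; move=> *; apply/and3P.
  apply/'forall_implyP => /= h Hh; apply/subsetP=> y yh.
  have Hh' := hinv_in hypH Hh.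
  have Hy: y \in car H.
    by apply: subsetP yh; rewrite !(hmulS_sub hypH) ?sub1set //; case/and3P: cU.
  have: dcoset H U h \in thin_elts (hquot H U) by rewrite -eH; apply: imset_f.
  rewrite inE => /andP[_]; rewrite hinv_quot // hmul_quot // => /eqP e.
  rewrite -dcoset_memE // -in_set1 -[[set U]]/[set hone (hquot H U)] -e.
  exact: imset_f.
have /(snormalP _ (hclosed_car))/andP[_ /'forall_implyP/= snH] := snU.
apply/eqP/esym/setP=> X; rewrite inE andb_idr // => /imsetP[h Hh ->].
have Hh' := hinv_in hypH Hh.
rewrite hinv_quot // hmul_quot // eqEsubset; apply/andP; split.
  apply/subsetP=> _ /imsetP[y yh ->]; rewrite inE dcoset_memE //.
    exact: subsetP (snH h Hh) _ yh.
  by apply: subsetP yh; rewrite !(hmulS_sub hypH) ?sub1set //; case/and3P: cU.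
rewrite sub1set; apply/imsetP; exists (hone H); last by rewrite dcoset1.
apply: (hmulS_mem (p := hinv H h) (q := h)); rewrite ?inE ?hone_hmulVs //.
by apply: (subsetP (hmulSs1 hypH cU _)); rewrite ?sub1set ?inE.
Qed.

Lemma card_quot U : hclosed H U -> normalizes (car H) U ->
  #|car (hquot H U)| = lcos_index U (car H).
Proof.
move=> cU nU; apply: eq_card => X.
by apply/imsetP/imsetP => -[h Hh ->]; exists h; rewrite ?dcoset_lcos.
Qed.

End Basics.

Section Valency.

Variables (T : finType) (H : hyperstruct T).
Hypothesis hypH : hypergroup H.
Implicit Types (U F W D N A B : {set T}).

Lemma hclosed_subhyper F A : hclosed (subhyper H F) A -> F \subset car H ->
  hclosed H A.
Proof.
by case/and3P=> /= sAF A0 AA sF; rewrite /hclosed A0 AA (subset_trans sAF).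
Qed.

Lemma subhyper_hclosed F A : hclosed H A -> A \subset F ->
  hclosed (subhyper H F) A.
Proof. by case/and3P=> /= _ A0 AA sF; apply/and3P. Qed.

Lemma rt_stepP F A B : hclosed H F ->
  rt_step (subhyper H F) A B -> snormal H A B /\ B \subset F.
Proof.
move=> cF /and4P[cA cB /proper_sub sAB].
have sF : F \subset car H by case/and3P: cF.
have cB' := hclosed_subhyper cB sF; have cA' := hclosed_subhyper cA sF.
have [sBF _ _] := and3P cB.
rewrite -[subhyper (subhyper H F) B]/(subhyper H B).
move/(thin_quotP (hypergroup_sub hypH cB') (subhyper_hclosed cA' sAB)).
by move=> [[_ _ _ nA] vA]; split.
Qed.

Lemma snormal_rt_step F A B : hclosed H F -> snormal H A B -> B \subset F ->
  A != B -> rt_step (subhyper H F) A B.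
Proof.
move=> cF [[cA cB sAB nA] vA] sBF neAB; apply/and4P; split.
- by apply: subhyper_hclosed => //; apply: subset_trans sBF.
- exact: subhyper_hclosed.
- by rewrite properEneq neAB.
rewrite -[subhyper (subhyper H F) B]/(subhyper H B).
have hypB := hypergroup_sub hypH cB.
apply/(thin_quotP hypB (subhyper_hclosed cA sAB)).
by do 2?[split=> //]; apply: subhyper_hclosed.
Qed.

Lemma rt_path_has_valency F A n s : hclosed H F -> has_valency H A n ->
  path (rt_step (subhyper H F)) A s ->
  has_valency H (last A s) (n * \prod_(AB <- zip (A :: s) s)
    #|car (hquot (subhyper (subhyper H F) AB.2) AB.1)|).
Proof.
move=> cF; elim: s A n => [|B s IH] A n rtA /=; first by rewrite big_nil muln1.
move=> /andP[stepAB pathB]; rewrite big_cons mulnA; apply: IH => //=.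
have [[[cA cB sAB nA] vA] sBF] := rt_stepP cF stepAB.
rewrite -[subhyper (subhyper H F) B]/(subhyper H B).
rewrite (card_quot (hypergroup_sub hypH cB)) ?subhyper_hclosed //.
by apply: has_valency_step.
Qed.

Lemma has_valency_rt_path G F n :
    hclosed H G -> has_valency H F n -> F \subset G ->
  exists2 s, path (rt_step (subhyper H G)) [set hone H] s
    & last [set hone H] s = F.
Proof.
move=> cG; elim=> {F n} [|U F n _ IH snU] sFG; first by exists [::].
have [[cU cF sUF _] _] := snU.
have [s ps ls] := IH (subset_trans sUF sFG).
have [eUF|neUF] := eqVneq U F; first by exists s => //; rewrite ls.
exists (rcons s F); last by rewrite last_rcons.
by rewrite rcons_path ps ls /= snormal_rt_step.
Qed.

Lemma rt_chain_has_valency F s : hclosed H F -> rt_chain (subhyper H F) s ->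
  has_valency H F (chain_valency (subhyper H F) s).
Proof.
move=> cF /andP[ps /eqP ls].
have := rt_path_has_valency cF (has_valency_one H) ps.
by rewrite mul1n -[hone H]/(hone (subhyper H F)) ls.
Qed.

Lemma valency_has_valency F n : hclosed H F -> has_valency H F n ->
  valency (subhyper H F) = n.
Proof.
move=> cF rtF; have [s ps ls] := has_valency_rt_path cF rtF (subxx F).
have : residually_thin (subhyper H F) by exists s; rewrite /rt_chain ps ls /=.
move/valency_gt0; rewrite /valency; case: pickP => // s' s'P _.
exact: has_valency_uniq (rt_chain_has_valency cF s'P) rtF.
Qed.

Lemma subhyper_car : subhyper H (car H) = H.
Proof. by case: H. Qed.

Lemma residually_thin_has_valency :
  residually_thin H -> has_valency H (car H) (valency H).
Proof.
have cH := hclosed_car hypH.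
rewrite -{1}subhyper_car => -[s /(rt_chain_has_valency cH) rts].
have vH := valency_has_valency cH rts; rewrite subhyper_car in vH.
by rewrite vH.
Qed.

End Valency.

(** * Thin elements as permutations *)

Section Thin.

Variables (T : finType) (K : hyperstruct T).
Hypothesis hypK : hypergroup K.
Implicit Types (U V W : {set T}) (a b c g h w x y z : T).

Lemma thin_mulr_uniq g x a b : g \in car K -> x \in car K ->
  hmul K (hinv K g) g = [set hone K] ->
  a \in hmul K x g -> b \in hmul K x g -> a = b.
Proof.
move=> Kg Kx g1 axg bxg; have Ka := hmul_in hypK Kx Kg axg.
have [z] := hmul_assocr hypK Ka (hinv_in hypK Kg) Kg (hmul_exchR hypK Kx Kg axg) bxg.
by rewrite g1 => /set1P->; rewrite (hmulr1 hypK) // => /set1P.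
Qed.

Lemma thin_mull_uniq g x a b : g \in car K -> x \in car K ->
  hmul K g (hinv K g) = [set hone K] ->
  a \in hmul K g x -> b \in hmul K g x -> a = b.
Proof.
move=> Kg Kx g1 agx bgx; have Ka := hmul_in hypK Kg Kx agx.
have [z] := hmul_assocl hypK Kg (hinv_in hypK Kg) Ka (hmul_exchL hypK Kg Kx agx) bgx.
by rewrite g1 => /set1P->; rewrite hmul1s // => /set1P.
Qed.

(** A closed subset of thin elements is a group under the hypermultiplication,
    whose products are singletons. *)
Definition grouplike W := hclosed K W && (W \subset thin_elts K).

Lemma grouplike_closed W : grouplike W -> hclosed K W.
Proof. by case/andP. Qed.

Lemma grouplike_thin W w : grouplike W -> w \in W ->
  [/\ w \in car K, hmul K (hinv K w) w = [set hone K]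
    & hmul K w (hinv K w) = [set hone K]].
Proof.
case/andP=> cW /subsetP tW Ww.
have := tW w Ww; rewrite inE => /andP[Kw /eqP w1].
have := tW _ (hclosedV hypK cW Ww).
by rewrite inE hinvK // => /andP[_ /eqP w2].
Qed.

(** The identity outside the hypergroup makes right multiplication by a thin
    element a permutation of the whole ambient type. *)
Definition rmul w x :=
  if x \in car K then odflt x [pick y in hmul K x w] else x.

(** The right regular representation.  It makes finite group theory available for
    grouplike sets inside the group of permutations of [T]; the default value is
    never reached for [w] in a grouplike set. *)
Definition reg w : {perm T} :=
  odflt 1%g [pick s : {perm T} | [forall x, s x == rmul w x]].

Lemma rmul_set W w x : grouplike W -> w \in W -> x \in car K ->
  hmul K x w = [set rmul w x].
Proof.
move=> gW Ww Kx; have [Kw w1 _] := grouplike_thin gW Ww.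
rewrite /rmul Kx; case: pickP => [y yxw|no_y] /=.
  apply/setP=> z; rewrite inE; apply/idP/eqP => [zxw|->//].
  exact: thin_mulr_uniq zxw yxw.
by have [y] := hmul_nonempty hypK Kx Kw; rewrite no_y.
Qed.

Lemma rmul_in W w x : grouplike W -> w \in W -> x \in car K ->
  rmul w x \in car K.
Proof.
move=> gW Ww Kx; have [Kw _ _] := grouplike_thin gW Ww.
by apply: (hmul_in hypK Kx Kw); rewrite (rmul_set gW Ww Kx) inE.
Qed.

Lemma rmulK W w : grouplike W -> w \in W -> cancel (rmul w) (rmul (hinv K w)).
Proof.
move=> gW Ww x; have [Kw w1 w2] := grouplike_thin gW Ww.
have Ww' := hclosedV hypK (grouplike_closed gW) Ww.
have [Kx|nKx] := boolP (x \in car K); last by rewrite /rmul !(negPf nKx).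
have Ky := rmul_in gW Ww Kx.
apply/esym/set1P; rewrite -(rmul_set gW Ww' Ky); apply: hmul_exchR => //.
by rewrite (rmul_set gW Ww Kx) inE.
Qed.

Lemma regE W w x : grouplike W -> w \in W -> reg w x = rmul w x.
Proof.
move=> gW Ww; rewrite /reg; case: pickP => [s /forallP/(_ x)/eqP //|].
move=> /(_ (perm (can_inj (rmulK gW Ww)))) /negP[].
by apply/forallP=> y; rewrite permE.
Qed.

Lemma reg_out W w x : grouplike W -> w \in W -> x \notin car K -> reg w x = x.
Proof. by move=> gW Ww nKx; rewrite (regE _ gW) // /rmul (negPf nKx). Qed.

Lemma reg_set W w x : grouplike W -> w \in W -> x \in car K ->
  hmul K x w = [set reg w x].
Proof. by move=> gW Ww Kx; rewrite (regE x gW Ww) (rmul_set gW Ww Kx). Qed.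

Lemma reg_one W w : grouplike W -> w \in W -> reg w (hone K) = w.
Proof.
move=> gW Ww; have [Kw _ _] := grouplike_thin gW Ww; apply/esym/set1P.
by rewrite -(reg_set gW Ww (hone_in hypK)) hmul1s ?inE.
Qed.

Lemma reg_mul W u v w : grouplike W -> u \in W -> v \in W ->
  w \in hmul K u v -> reg w = (reg u * reg v)%g.
Proof.
move=> gW Wu Wv wuv; have cW := grouplike_closed gW.
have Ww := hclosedM hypK cW Wu Wv wuv.
have [[Ku _ _] [Kv _ _]] := (grouplike_thin gW Wu, grouplike_thin gW Wv).
apply/permP=> x; rewrite permM.
have [Kx|nKx] := boolP (x \in car K); last first.
  by rewrite !(reg_out gW, reg_out gW Wu, reg_out gW Wv).
have : reg w x \in hmul K x w by rewrite (reg_set gW) ?inE.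
case/(hmul_assocl hypK Kx Ku Kv wuv) => z.
rewrite (reg_set gW Wu Kx) => /set1P->.
by rewrite (reg_set gW Wv) ?(regE _ gW Wu) ?(rmul_in gW Wu) // => /set1P.
Qed.

Lemma reg_inj W : grouplike W -> {in W &, injective reg}.
Proof. by move=> gW u v Wu Wv e; rewrite -(reg_one gW Wu) e (reg_one gW). Qed.

Lemma reg_group_set W : grouplike W -> group_set (reg @: W).
Proof.
move=> gW; have cW := grouplike_closed gW.
have W1 := hclosed1 hypK cW.
apply/group_setP; split.
  apply/imsetP; exists (hone K) => //; apply/permP=> x.
  rewrite perm1 (regE _ gW) //.
  have [Kx|nKx] := boolP (x \in car K); last by rewrite /rmul (negPf nKx).
  by apply/set1P; rewrite -(rmul_set gW W1 Kx) (hmulr1 hypK) ?inE.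
move=> _ _ /imsetP[u Wu ->] /imsetP[v Wv ->].
have [[Ku _ _] [Kv _ _]] := (grouplike_thin gW Wu, grouplike_thin gW Wv).
have [w wuv] := hmul_nonempty hypK Ku Kv.
rewrite -(reg_mul gW Wu Wv wuv); apply: imset_f.
exact: (hclosedM hypK cW) wuv.
Qed.

Definition reg_group W (gW : grouplike W) : {group {perm T}} :=
  Group (reg_group_set gW).

Lemma card_reg W (gW : grouplike W) : #|reg_group gW| = #|W|.
Proof. exact: card_in_imset (reg_inj gW). Qed.

(** Permutations that commute with all left multiplications; right
    multiplications by thin elements do so by associativity. *)
Definition left_linear (s : {perm T}) : Prop := forall x, x \in car K ->
  s x \in car K /\ forall h, h \in car K -> hmul K h (s x) = s @: hmul K h x.

Lemma left_linear_reg W w : grouplike W -> w \in W -> left_linear (reg w).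
Proof.
move=> gW Ww x Kx; have [Kw _ _] := grouplike_thin gW Ww.
split; first by rewrite (regE _ gW Ww) (rmul_in gW Ww).
move=> h Kh; rewrite -[LHS]hmulS11 -(reg_set gW Ww Kx).
rewrite (hmulA hypK) //; apply/setP=> y; apply/hmulSP/imsetP.
  move=> [z [_ [zhx /set1P->]]].
  by rewrite (reg_set gW Ww (hmul_in hypK Kh Kx zhx)) => /set1P->; exists z.
move=> [z zhx ->]; exists z, w.
by rewrite (reg_set gW Ww (hmul_in hypK Kh Kx zhx)) !inE.
Qed.

Lemma left_linear1 : left_linear 1%g.
Proof.
move=> x Kx; rewrite perm1; split=> // h Kh.
by rewrite -[LHS]imset_id; apply: eq_imset => y; rewrite perm1.
Qed.

Lemma left_linearM s t :
  left_linear s -> left_linear t -> left_linear (s * t)%g.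
Proof.
move=> ls lt x Kx; have [Ksx esx] := ls x Kx; have [Ktsx etsx] := lt _ Ksx.
rewrite permM; split=> // h Kh; rewrite etsx // esx // -imset_comp.
by apply: eq_imset => y; rewrite permM.
Qed.

Lemma left_linearX s n : left_linear s -> left_linear (s ^+ n)%g.
Proof.
move=> ls; elim: n => [|n IH]; first by rewrite expg0; apply: left_linear1.
by rewrite expgS; apply: left_linearM.
Qed.
Lemma reg_comm U V u v : grouplike U -> grouplike V -> u \in U -> v \in V ->
  hmul K u v = hmul K v u -> commute (reg u) (reg v).
Proof.
move=> gU gV Uu Vv cuv.
have [[Ku _ _] [Kv _ _]] := (grouplike_thin gU Uu, grouplike_thin gV Vv).
apply/permP=> x; rewrite !permM.
have [Kx|nKx] := boolP (x \in car K); last first.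
  by rewrite !(reg_out gU Uu, reg_out gV Vv).
have Kxu : reg u x \in car K by case: (left_linear_reg gU Uu Kx).
have Kxv : reg v x \in car K by case: (left_linear_reg gV Vv Kx).
apply/set1P; rewrite -(reg_set gU Uu Kxv).
have : reg v (reg u x) \in hmul K (reg u x) v by rewrite (reg_set gV) ?inE.
case/(hmul_assocr hypK Kx Ku Kv (z := reg u x)) => [|y].
  by rewrite (reg_set gU) ?inE.
rewrite cuv => yvu; case/(hmul_assocl hypK Kx Kv Ku yvu) => z.
by rewrite (reg_set gV Vv Kx) => /set1P->.
Qed.

Lemma reg_pow_fix (s : {perm T}) x n k :
  coprime #[s]%g n -> (s ^+ n)%g x = x -> (s ^+ k)%g x = x.
Proof.
move=> co_sn fix_sn.
have fix_pow (t : {perm T}) j : t x = x -> (t ^+ j)%g x = x.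
  by move=> tx; elim: j => [|j IH]; rewrite ?expg0 ?perm1 // expgS permM tx.
apply: (fix_pow); rewrite -(expgK (G := <[s]>%G) co_sn (cycle_id s)).
exact: fix_pow.
Qed.

Lemma reg_powS V h k : grouplike V -> h \in V ->
  hmul K h ((reg h ^+ k)%g (hone K)) = [set (reg h ^+ k.+1)%g (hone K)].
Proof.
move=> gV Vh; have [Kh _ _] := grouplike_thin gV Vh.
have ls := left_linearX k (left_linear_reg gV Vh).
have [_ ->] := ls _ (hone_in hypK); last by [].
by rewrite (hmulr1 hypK) // imset_set1 expgS permM (reg_one gV).
Qed.

(** Write [h x = x h w] with [w] in [W].  Since left multiplication by [h] commutes
    with right multiplications and [h] commutes with [w], one gets
    [h^k x = x h^k w^k] for all [k].  For [k = p] this reads [x = x w^p], and then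
    [x w = x] because the order of [w] is prime to [p]. *)
Lemma commute_mod_coprime V W h x p : grouplike V -> grouplike W ->
    h \in V -> (reg h ^+ p = 1)%g -> coprime #|W| p ->
    (forall w, w \in W -> hmul K h w = hmul K w h) ->
    x \in car K -> hmul K h x \subset hmulS K (hmul K x h) W ->
  hmul K h x = hmul K x h.
Proof.
move=> gV gW Vh hp coWp cWh Kx hxW; have [Kh h1 h2] := grouplike_thin gV Vh.
have [y yhx] := hmul_nonempty hypK Kh Kx.
have hxE z : z \in hmul K h x -> hmul K h x = [set z].
  move=> zhx; apply/setP=> t; rewrite inE; apply/idP/eqP => [thx|->//].
  exact: thin_mull_uniq thx zhx.
have /hmulSP[z [w [zxh Ww yzw]]] := subsetP hxW y yhx.
move: zxh yzw; rewrite (reg_set gV Vh Kx) => /set1P->.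
have [Khx _] := left_linear_reg gV Vh Kx.
rewrite (reg_set gW Ww Khx) => /set1P ey.
have c_hw := reg_comm gV gW Vh Ww (cWh w Ww).
pose s := (reg h * reg w)%g.
have ysx : y = s x by rewrite ey permM.
have ls : left_linear s.
  by apply: left_linearM; [apply: left_linear_reg Vh | apply: left_linear_reg Ww].
(* (reg h ^+ k) 1 is the k-th power of h as an element *)
have powE k : hmul K ((reg h ^+ k)%g (hone K)) x = [set (s ^+ k)%g x].
  elim: k => [|k IH]; first by rewrite !expg0 !perm1 hmul1s.
  have [Kz _] := left_linearX k (left_linear_reg gV Vh) (hone_in hypK).
  rewrite -[LHS]hmulS11 -(reg_powS k gV Vh) -(hmulA hypK) // IH hmulS11.
  have [_ ->] := left_linearX k ls Kx; last by [].
  by rewrite (hxE y yhx) imset_set1 ysx expgS (permM s).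
have := powE p; rewrite hp perm1 hmul1s // => /esym/set1_inj.
rewrite (expgMn _ c_hw) hp mul1g => fix_w.
have wx : reg w x = x.
  rewrite -[reg w]expg1; apply: reg_pow_fix fix_w.
  apply: coprime_dvdl coWp; rewrite -(card_reg gW) order_dvdG //.
  exact: imset_f.
rewrite (hxE y yhx) ey; congr [set _].
by have /permP/(_ x) := c_hw; rewrite !permM wx.
Qed.

End Thin.

(** * Centres and central series *)

Section CentralSeries.

Variables (T : finType) (K : hyperstruct T).
Hypothesis hypK : hypergroup K.
Implicit Types (V W : {set T}) (a b c g h w x y z : T).

Lemma centerP c : reflect
  [/\ c \in car K, forall x, x \in car K -> hmul K c x = hmul K x c
    & hmul K (hinv K c) c = [set hone K]]
  (c \in center K).
Proof.
rewrite inE; apply: (iffP and3P) => [[Kc /forall_inP cc /eqP c1]|[Kc cc c1]].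
  by split=> // x Kx; apply/eqP/cc.
by split; [|apply/forall_inP=> x Kx; apply/eqP/cc|apply/eqP].
Qed.

Lemma center_thinr c : c \in center K -> hmul K c (hinv K c) = [set hone K].
Proof. by move=> /centerP[Kc cc c1]; rewrite cc // (hinv_in hypK). Qed.

Lemma centerV c : c \in center K -> hinv K c \in center K.
Proof.
move=> Zc; have /centerP[Kc cc c1] := Zc; have Kc' := hinv_in hypK Kc.
apply/centerP; split=> //; last by rewrite hinvK // center_thinr.
move=> x Kx; apply/setP=> y; apply/idP/idP => yx.
  have Ky := hmul_in hypK Kc' Kx yx.
  have := hmul_exchL hypK Kc' Kx yx; rewrite hinvK // cc // => xyc.
  exact: hmul_exchR.
have Ky := hmul_in hypK Kx Kc' yx.
have := hmul_exchR hypK Kx Kc' yx; rewrite hinvK // -cc // => xcy.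
exact: hmul_exchL.
Qed.

Lemma centerM a b z : a \in center K -> b \in center K ->
  z \in hmul K a b -> z \in center K.
Proof.
move=> Za Zb zab; have /centerP[Ka ca a1] := Za; have /centerP[Kb cb b1] := Zb.
have Kz := hmul_in hypK Ka Kb zab.
have abz : hmul K a b = [set z].
  apply/setP=> t; rewrite inE; apply/idP/eqP => [tab|->//].
  exact: thin_mulr_uniq tab zab.
apply/centerP; split=> // [x Kx|].
  rewrite -[LHS]hmulS11 -abz -(hmulA hypK) // cb // (hmulA hypK) // ca //.
  by rewrite -(hmulA hypK) // abz hmulS11.
have [Ka' Kb'] := (hinv_in hypK Ka, hinv_in hypK Kb).
have Kz' := hinv_in hypK Kz.
apply/eqP; rewrite eqEsubset sub1set hone_hmulVs // andbT.
apply/subsetP=> t tzz; rewrite -b1.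
(* z^* z lies in (b^* a^* )(a b) = b^* (a^* a) b *)
have [u uza tub] := hmul_assocl hypK Kz' Ka Kb zab tzz.
have [v vaa ubv] := hmul_assocr hypK Kb' Ka' Ka (hinv_hmul hypK Ka Kb zab) uza.
move: vaa ubv tub; rewrite a1 => /set1P->.
by rewrite (hmulr1 hypK) // => /set1P->.
Qed.

Lemma hclosed_center : hclosed K (center K).
Proof.
apply/and3P; split.
- by apply/subsetP=> c /centerP[].
- apply/set0Pn; exists (hone K); apply/centerP; split.
  + exact: hone_in.
  + by move=> x Kx; rewrite hmul1s // (hmulr1 hypK).
  by rewrite hinv1 // (hmulr1 hypK) // hone_in.
apply/subsetP=> z /hmulSP[_ [b [/imsetP[a Za ->] Zb]]].
by apply: centerM => //; apply: centerV.
Qed.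

(** For a normal closed [N] this says that the class of [h] is central in the
    quotient by [N], without leaving the hypergroup. *)
Definition central_mod N h : Prop :=
  [/\ h \in car K,
      forall x, x \in car K -> hmul K h x \subset hmulS K (hmul K x h) N
    & hmul K (hinv K h) h \subset N].

Record central_series (W : nat -> {set T}) (n : nat) : Prop := {
  cs_one : W 0 = [set hone K];
  cs_car : W n = car K;
  cs_closed : forall i, hclosed K (W i);
  cs_central : forall i h, h \in W i.+1 -> central_mod (W i) h
}.

Definition p'_thin p W := grouplike K W && ~~ (p %| #|W|).

(** For [w] in [W], [w] lies in [h^* h] iff [h] lies in [h w], that is iff right
    multiplication by [w] fixes [h]; so [h^* h] is the stabiliser of [h] in the
    group [W]. *)
Lemma card_thin_factor_dvd W h : grouplike K W -> h \in car K ->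
  hmul K (hinv K h) h \subset W -> #|hmul K (hinv K h) h| %| #|W|.
Proof.
move=> gW Kh /subsetP hhW; have Kh' := hinv_in hypK Kh.
have hhE w : (w \in hmul K (hinv K h) h) = (w \in W) && (reg K w h == h).
  apply/idP/andP => [whh|[Ww /eqP wh]].
    have Ww := hhW w whh; split=> //; rewrite eq_sym -in_set1.
    rewrite -(reg_set hypK gW Ww Kh) -{2}(hinvK hypK Kh).
    exact: hmul_exchL.
  have [Kw _ _] := grouplike_thin hypK gW Ww.
  by apply: hmul_exchL => //; rewrite (reg_set hypK gW Ww Kh) wh inE.
rewrite -(card_reg hypK gW).
have <- : #|'C_(reg_group hypK gW)[h | 'P]%g| = #|hmul K (hinv K h) h|.
  rewrite -[RHS](card_in_imset (f := reg K)); last first.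
    by move=> u v /hhW Wu /hhW Wv; apply: (reg_inj hypK gW).
  apply: eq_card => s.
  apply/setIP/imsetP => [[/imsetP[w Ww ->] /astab1P wh]|[w]].
    by exists w => //; rewrite hhE Ww; apply/eqP.
  rewrite hhE => /andP[Ww /eqP wh] ->; split; first exact: imset_f.
  by apply/astab1P.
by rewrite cardSg // subsetIl.
Qed.

(** The order of [h^* h] is both a power of [p] and, as that of a subgroup of
    [W i], prime to [p]. *)
Lemma thin_central_series (W : nat -> {set T}) n p i :
    prime p -> central_series W n ->
    (forall h, h \in car K -> hmul K (hinv K h) h \subset thin_elts K ->
       p_number p #|hmul K (hinv K h) h|) ->
  p'_thin p (W i) -> grouplike K (W i.+1).
Proof.
move=> p_pr csW pval /andP[gW p'W]; rewrite /grouplike (cs_closed csW) /=.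
apply/subsetP=> h Wh; have [Kh _ hhW] := cs_central csW Wh.
have [k hhk] := pval h Kh (subset_trans hhW (proj2 (andP gW))).
have hh_dvd := card_thin_factor_dvd gW Kh hhW.
have : #|hmul K (hinv K h) h| == 1.
  move: hh_dvd; rewrite hhk; case: k {hhk} => // k /(dvdn_trans _) dvdW.
  by case/negP: p'W; apply: dvdW; rewrite expnS dvdn_mulr.
case/cards1P=> z hhz; rewrite inE Kh hhz; have := hone_hmulVs hypK Kh.
by rewrite hhz inE => /eqP->; rewrite eqxx.
Qed.

(** By induction, [h] centralises [W i].  An element [w] of [W i.+1] is central
    modulo [W i], so [h w] and [w h] differ by a factor in [W i] and
    [commute_mod_coprime] applies. *)
Lemma pelt_commutes (W : nat -> {set T}) n p V h i :
    prime p -> central_series W n ->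
    grouplike K V -> h \in V -> (reg K h ^+ p = 1)%g ->
    (forall j, j <= i -> p'_thin p (W j)) ->
  forall w, w \in W i -> hmul K h w = hmul K w h.
Proof.
move=> p_pr csW gV Vh hp; have [Kh _ _] := grouplike_thin hypK gV Vh.
elim: i => [|i IH] p'W w.
  by rewrite (cs_one csW) => /set1P->; rewrite hmul1s // (hmulr1 hypK).
move=> Ww; have /andP[gWi p'Wi] := p'W i (leqnSn i).
have /andP[gWS _] := p'W _ (leqnn i.+1).
have [Kw cw _] := cs_central csW Ww.
have cWh v : v \in W i -> hmul K h v = hmul K v h.
  by apply: IH => j ji; apply: p'W; apply: leqW.
apply: (commute_mod_coprime hypK gV gWi Vh hp _ cWh Kw).
  by rewrite coprime_sym prime_coprime.
have [y ywh] := hmul_nonempty hypK Kw Kh.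
have /hmulSP[z [v [zhw Wv yzv]]] := subsetP (cw h Kh) y ywh.
have [Kv _ _] := grouplike_thin hypK gWi Wv.
have Kz := hmul_in hypK Kh Kw zhw.
have Wv' := hclosedV hypK (grouplike_closed gWi) Wv.
apply/subsetP=> t thw; have [_ h1 h2] := grouplike_thin hypK gV Vh.
rewrite (thin_mull_uniq hypK Kh Kw h2 thw zhw).
by apply: hmulS_mem ywh Wv' _; apply: hmul_exchR.
Qed.

(** The cyclic group generated by [h], transported back from permutations. *)
Lemma central_subgroup_of_prime_order V h p : prime p -> grouplike K V ->
    h \in V -> #[reg K h]%g = p -> h \in center K ->
  exists C, [/\ hclosed K C, C \subset center K & #|C| = p].
Proof.
move=> p_pr gV Vh oh Zh; have cV := grouplike_closed gV.
pose C := [set g in V | reg K g \in <[reg K h]>%g].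
have sCV : C \subset V by apply/subsetP=> g; rewrite inE => /andP[].
exists C; split.
- apply/and3P; split; first by apply: subset_trans sCV _; case/and3P: cV.
    by apply/set0Pn; exists h; rewrite inE Vh cycle_id.
  apply/subsetP=> z /hmulSP[_ [b [/imsetP[a + ->] + zab]]].
  rewrite !inE => /andP[Va ha] /andP[Vb hb].
  have Va' := hclosedV hypK cV Va; have Ka := hclosed_sub cV Va.
  rewrite (hclosedM hypK cV Va' Vb zab) /=.
  have ez := reg_mul hypK gV Va (hclosedVM hypK cV Va Vb zab).
  have Kb := hclosed_sub cV Vb.
  have := hmul_exchL hypK (hinv_in hypK Ka) Kb zab; rewrite hinvK // => /ez eb.
  by rewrite -(groupMl _ ha) -eb.
- apply/subsetP=> g; rewrite inE => /andP[Vg /cycleP[k eg]].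
  rewrite -(reg_one hypK gV Vg) eg; elim: k {eg} => [|k IH].
    by rewrite expg0 perm1; apply: (hclosed1 hypK hclosed_center).
  by apply: (centerM Zh IH); rewrite (reg_powS hypK k gV Vh) inE.
rewrite -oh orderE -(card_in_imset (f := reg K) (D := mem C)); last first.
  by move=> a b /(subsetP sCV) Va /(subsetP sCV) Vb; apply: (reg_inj hypK gV).
apply: eq_card => s; apply/imsetP/idP => [[g]|hs].
  by rewrite inE => /andP[_ hg] ->.
have : s \in reg_group hypK gV.
  by apply: subsetP hs; rewrite cycle_subG; apply: imset_f.
by case/imsetP=> g Vg eg; exists g; rewrite // inE Vg -eg.
Qed.

(** Climbing the series, the first term whose order is divisible by [p] contains
    an element of order [p], which centralises everything. *)
Lemma central_series_dichotomy (W : nat -> {set T}) n p :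
    prime p -> central_series W n ->
    (forall h, h \in car K -> hmul K (hinv K h) h \subset thin_elts K ->
       p_number p #|hmul K (hinv K h) h|) ->
  (exists C, [/\ hclosed K C, C \subset center K & #|C| = p])
  \/ p'_thin p (car K).
Proof.
move=> p_pr csW pval; rewrite -(cs_car csW).
suff: (exists C, [/\ hclosed K C, C \subset center K & #|C| = p])
    \/ (forall j, j <= n -> p'_thin p (W j)).
  by case=> [|p'W]; [left | right; apply: p'W].
move: (n) => m; elim: m => [|i [|p'W]]; [right=> [[|//]] _ | by left |].
  rewrite /p'_thin (cs_one csW) cards1 dvdn1 neq_ltn prime_gt1 // orbT andbT.
  rewrite /grouplike hclosed_one //=; apply/subsetP=> _ /set1P->.
  by rewrite inE hinv1 // (hmulr1 hypK) (hone_in hypK) ?eqxx.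
have gWS := thin_central_series p_pr csW pval (p'W i (leqnn i)).
have [p_dvd|p'WS] := boolP (p %| #|W i.+1|); last first.
  right=> j; rewrite leq_eqVlt => /predU1P[->|]; last exact: p'W.
  by rewrite /p'_thin gWS.
left; have : p %| #|reg_group hypK gWS| by rewrite card_reg.
case/(pgroup.Cauchy p_pr)=> _ /imsetP[h Wh ->] oh.
apply: (central_subgroup_of_prime_order p_pr gWS Wh oh).
have hp : (reg K h ^+ p = 1)%g by rewrite -oh expg_order.
have [Kh h1 h2] := grouplike_thin hypK gWS Wh.
have /andP[gW p'Wi] := p'W i (leqnn i).
apply/centerP; split=> // x Kx.
apply: (commute_mod_coprime hypK gWS gW Wh hp) => //.
- by rewrite coprime_sym prime_coprime.
- exact: (pelt_commutes p_pr csW gWS Wh hp p'W).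
by have [_ ch _] := cs_central csW Wh; apply: ch.
Qed.
End CentralSeries.

(** * Quotients *)

Section Quotient.

Variables (T : finType) (H : hyperstruct T).
Hypothesis hypH : hypergroup H.
Implicit Types (U F W D N A B : {set T}) (a b f h q x y z : T).

Lemma hnormalP N :
  reflect (hclosed H N /\ normalizes H (car H) N) (hnormal H N).
Proof.
apply: (iffP andP) => -[cN nN]; split=> //.
  move=> u f y Nu Hf yuf; apply: subsetP (forall_inP nN f Hf) _ _.
  by apply: hmulS_mem yuf; rewrite ?inE.
apply/forall_inP=> h Hh; apply/subsetP=> y /hmulSP[u [_ [Nu /set1P-> yuh]]].
exact: nN yuh.
Qed.

Lemma dcoset_car N X : X \in car (hquot H N) ->
  exists2 h, h \in car H & X = dcoset H N h.
Proof. by case/imsetP=> h Hh ->; exists h. Qed.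

Lemma sub_preim N (C : {set {set T}}) : hclosed H N -> hclosed (hquot H N) C ->
  N \subset [set h in car H | dcoset H N h \in C].
Proof.
move=> cN cC; apply/subsetP=> u Nu; have Hu := hclosed_sub cN Nu.
have /eqP eu : dcoset H N u == N by rewrite dcoset_memE.
by rewrite inE Hu eu; apply: (hclosed1 (hypergroup_quot hypH cN) cC).
Qed.

Lemma hclosed_preim N (C : {set {set T}}) : hclosed H N ->
  hclosed (hquot H N) C -> hclosed H [set h in car H | dcoset H N h \in C].
Proof.
move=> cN cC; apply/and3P; split.
- by apply/subsetP=> h; rewrite inE => /andP[].
- apply/set0Pn; exists (hone H); apply: (subsetP (sub_preim cN cC)).
  exact: (hclosed1 hypH).
apply/subsetP=> z /hmulSP[_ [b [/imsetP[a + ->] + zab]]].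
rewrite !inE => /andP[Ha Ca] /andP[Hb Cb]; have Ha' := hinv_in hypH Ha.
rewrite (hmul_in hypH Ha' Hb zab) /=.
apply: (hclosedVM (hypergroup_quot hypH cN) cC Ca Cb).
rewrite hinv_quot // hmul_quot //; apply: imset_f.
apply: (hmulS_mem _ _ zab); rewrite ?inE //.
by apply: (subsetP (hmulSs1 hypH cN _)); rewrite ?sub1set ?inE.
Qed.

Section NormalQuotient.

Variable N : {set T}.
Hypotheses (cN : hclosed H N) (nN : normalizes H (car H) N).

Let hypQ := hypergroup_quot hypH cN.

(** As [N] is normal, [(a N) b] and [(a b) N] have the same classes. *)
Lemma quot_mulE a b y : a \in car H -> b \in car H -> y \in car H ->
  (dcoset H N y \in hmul (hquot H N) (dcoset H N a) (dcoset H N b))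
  = (y \in hmulS H (hmul H a b) N).
Proof.
move=> Ha Hb Hy; rewrite hmul_quot //.
apply/imsetP/hmulSP => [[w wab eyw]|[e [m [eab Nm yem]]]].
  move/hmulSP: wab => [z [_ [/hmulSP[_ [n [/set1P-> Nn zan]]] /set1P-> wzb]]].
  have Hn := hclosed_sub cN Nn; have Hz := hmul_in hypH Ha Hn zan.
  have Hw := hmul_in hypH Hz Hb wzb.
  have [t tnb wat] := hmul_assocr hypH Ha Hn Hb zan wzb.
  have /lcosP[m Nm tbm] := nN Nn Hb tnb.
  have [e eab wem] := hmul_assocl hypH Ha Hb (hclosed_sub cN Nm) tbm wat.
  have He := hmul_in hypH Ha Hb eab.
  have yw : y \in lcos H N w by rewrite -dcoset_lcos // -eyw dcoset_refl.
  have we : w \in lcos H N e by apply/lcosP; exists m.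
  by have /lcosP[m' Nm' yem'] := lcos_trans hypH cN He we yw; exists e, m'.
have He := hmul_in hypH Ha Hb eab.
exists e; last first.
  by rewrite !dcoset_lcos //; apply: lcos_eq => //; apply/lcosP; exists m.
apply: hmulS_mem eab; rewrite ?inE //.
by apply: (subsetP (hmulSs1 hypH cN _)); rewrite ?sub1set ?inE.
Qed.

Lemma quot_mul_mem a b y : a \in car H -> b \in car H -> y \in hmul H a b ->
  dcoset H N y \in hmul (hquot H N) (dcoset H N a) (dcoset H N b).
Proof.
move=> Ha Hb yab; have Hy := hmul_in hypH Ha Hb yab; rewrite quot_mulE //.
by apply: (subsetP (hmulSs1 hypH cN _)); rewrite ?(hmul_sub hypH).
Qed.

Lemma quot_mulP a b X : a \in car H -> b \in car H ->
  reflect (exists2 e, e \in hmul H a b & X = dcoset H N e)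
          (X \in hmul (hquot H N) (dcoset H N a) (dcoset H N b)).
Proof.
move=> Ha Hb; apply: (iffP idP) => [abX|[e eab ->]]; last exact: quot_mul_mem.
have [y Hy eX] : exists2 y, y \in car H & X = dcoset H N y.
  apply: dcoset_car; apply: (hmul_in hypQ) abX; exact: imset_f.
move: abX; rewrite eX quot_mulE // => /hmulSP[e [m [eab Nm yem]]].
exists e => //; have He := hmul_in hypH Ha Hb eab.
by rewrite !dcoset_lcos //; apply: lcos_eq => //; apply/lcosP; exists m.
Qed.

Lemma central_lift h : h \in car H -> dcoset H N h \in center (hquot H N) ->
  central_mod H N h /\
  forall x, x \in car H -> hmul H x h \subset hmulS H (hmul H h x) N.
Proof.
move=> Hh /centerP[_ ch h1].
have Hh' := hinv_in hypH Hh.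
split; first split=> // [x Hx|].
- apply/subsetP=> y yhx; have Hy := hmul_in hypH Hh Hx yhx.
  by rewrite -quot_mulE // -ch ?imset_f // quot_mul_mem.
- apply/subsetP=> y yhh; have Hy := hmul_in hypH Hh' Hh yhh.
  rewrite -(dcoset_memE hypH) // -in_set1 -[[set N]]h1 hinv_quot //.
  exact: quot_mul_mem.
move=> x Hx; apply/subsetP=> y yxh; have Hy := hmul_in hypH Hx Hh yxh.
by rewrite -quot_mulE // ch ?imset_f // quot_mul_mem.
Qed.

Lemma central_series_quot (W : nat -> {set T}) n : central_series H W n ->
  central_series (hquot H N) (fun i => [set dcoset H N h | h in W i]) n.
Proof.
move=> csW; have cW := cs_closed csW.
have HW i h : h \in W i -> h \in car H by apply: hclosed_sub.
split=> [||i|i _ /imsetP[h Wh ->]].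
- by rewrite (cs_one csW) imset_set1 dcoset1.
- by rewrite (cs_car csW).
- apply/and3P; split.
  + by apply/subsetP=> _ /imsetP[h /HW Hh ->]; apply: imset_f.
  + apply/set0Pn; exists (dcoset H N (hone H)); apply: imset_f.
    exact: (hclosed1 hypH).
  apply/subsetP=> X /hmulSP[X1 [X2 []]].
  move=> /imsetP[_ /imsetP[a Wa ->] ->] /imsetP[b Wb ->].
  rewrite hinv_quot ?(HW i) //.
  case/quot_mulP; rewrite ?(hinv_in hypH) ?(HW i) // => e eab ->.
  exact: imset_f (hclosedVM hypH (cW i) Wa Wb eab).
have [Hh ch hh] := cs_central csW Wh; split; first exact: imset_f.
  move=> _ /dcoset_car[x Hx ->]; apply/subsetP=> X /quot_mulP[] // e ehx ->.
  have /hmulSP[f [w [fxh Ww efw]]] := subsetP (ch x Hx) e ehx.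
  have Hf := hmul_in hypH Hx Hh fxh.
  apply: (hmulS_mem (p := dcoset H N f) (q := dcoset H N w)).
  - exact: quot_mul_mem.
  - exact: imset_f.
  by apply: quot_mul_mem => //; apply: HW Ww.
apply/subsetP=> X; rewrite hinv_quot //.
case/quot_mulP=> //; first exact: hinv_in.
by move=> e ehh ->; apply: imset_f; apply: subsetP ehh.
Qed.

End NormalQuotient.

(** Modulo a normal [Z], a central [u] satisfies [u f <= (f u) Z], and [u Z] stays
    inside the next term. *)
Lemma upper_center_normal i :
  hclosed H (upper_center H i) /\ normalizes H (car H) (upper_center H i).
Proof.
elim: i => [|i [cZ nZ]] /=.
  split; first exact: hclosed_one.
  move=> _ f y /set1P-> Hf; rewrite hmul1s // => /set1P->.
  exact: lcos_refl (hclosed_one hypH) Hf.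
have cC := hclosed_center (hypergroup_quot hypH cZ).
split; first exact: hclosed_preim.
move=> u f y; rewrite inE => /andP[Hu Zu] Hf yuf.
have [[_ cu _] _] := central_lift cZ nZ Hu Zu.
have /hmulSP[e [m [efu Zm yem]]] := subsetP (cu f Hf) y yuf.
have [t tum yft] := hmul_assocr hypH Hf Hu (hclosed_sub cZ Zm) efu yem.
apply/lcosP; exists t => //.
apply: (hclosedM hypH (hclosed_preim cZ cC) _ _ tum); first by rewrite inE Hu.
exact: (subsetP (sub_preim cZ cC)).
Qed.

Lemma upper_central_series n : upper_center H n = car H ->
  central_series H (upper_center H) n.
Proof.
move=> eZ; split=> // [i|i h] /=; first by case: (upper_center_normal i).
have [cZ nZ] := upper_center_normal i.
by rewrite inE => /andP[Hh Zh]; case: (central_lift cZ nZ Hh Zh).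
Qed.

End Quotient.

(** * Sylow subsets *)

Section Sylow.

Variables (T : finType) (H : hyperstruct T) (p : nat) (P N : {set T}).
Hypotheses (hypH : hypergroup H) (p_pr : prime p).
Hypotheses (rtH : residually_thin H) (sylP : sylow_subset p H P).
Hypotheses (cN : hclosed H N) (nN : normalizes H (car H) N) (sNP : N \subset P).

Lemma sylow_has_valency : exists k m, [/\ hclosed H P, has_valency H P (p ^ k),
  valency H = p ^ k * m & ~~ (p %| m)].
Proof.
have [[cP [k pk]] [dvP [_ p'P]]] := sylP.
have sPH : P \subset car H by case/and3P: cP.
have rtn := residually_thin_has_valency hypH rtH.
have [n rtP _] := has_valency_sub hypH rtn cP sPH.
exists k, (valency H %/ valency (subhyper H P)); split=> //.
  by rewrite -pk (valency_has_valency hypH cP rtP).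
by rewrite -pk mulnC divnK.
Qed.

(** The preimage [Q] of [C] is normal because elements commute with it modulo [N].
    For the same reason [P] is strongly normal in [Q P], with index that of
    [P :&: Q] in [Q], which is [1] or [p]. *)
Lemma central_extension_in_sylow (C : {set {set T}}) :
    hclosed (hquot H N) C -> C \subset center (hquot H N) -> #|C| = p ->
  exists Q : {set T}, [/\ hnormal H Q, Q \subset P & N \proper Q].
Proof.
move=> cC sCZ oC; pose Q := [set h in car H | dcoset H N h \in C].
have cQ : hclosed H Q by apply: hclosed_preim.
have sNQ : N \subset Q by apply: sub_preim.
have HQ := hclosed_sub cQ.
have QZ q : q \in Q -> central_mod H N q /\
    forall x, x \in car H -> hmul H x q \subset hmulS H (hmul H q x) N.
  by rewrite inE => /andP[Hq Cq]; apply: central_lift; rewrite ?(subsetP sCZ).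
have snNQ : snormal H N Q.
  split; first by split=> // u f y Nu /HQ Hf; apply: nN.
  by move=> f y /QZ[[_ _ /subsetP sffN] _]; apply: sffN.
have idxNQ : lcos_index H N Q = p.
  rewrite -oC; apply: eq_card => X; apply/imsetP/idP => [[h]|CX].
    by rewrite inE => /andP[Hh Ch] ->; rewrite -dcoset_lcos.
  have /dcoset_car[h Hh eX] := hclosed_sub cC CX.
  by exists h; rewrite ?inE ?Hh -?eX // -dcoset_lcos.
have [k [m [cP rtP vH p'm]]] := sylow_has_valency.
have nP : normalizes H Q P.
  move=> u q y Pu Qq yuq; have [Hu Hq] := (hclosed_sub cP Pu, HQ q Qq).
  have /hmulSP[e [n [equ Nn yen]]] := subsetP (proj2 (QZ q Qq) u Hu) y yuq.
  have [t tun yqt] := hmul_assocr hypH Hq Hu (hclosed_sub cN Nn) equ yen.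
  apply/lcosP; exists t => //; apply: (hclosedM hypH cP Pu _ tun).
  exact: subsetP Nn.
have snP : snormal H P (hmulS H Q P).
  apply: snormal_mul_closed => // q y Qq yqq; apply: (subsetP sNP).
  by have [[_ _ /subsetP vN] _] := QZ q Qq; apply: vN.
have sQF : Q \subset hmulS H Q P by apply: (hmulSs1 hypH cP); case/and3P: cQ.
have cPQ := hclosedI hypH cP cQ.
exists Q; split.
- apply/hnormalP; split=> // q x y Qq Hx yqx; have Hq := HQ q Qq.
  have [[_ cq _] _] := QZ q Qq.
  have /hmulSP[e [n [exq Nn yen]]] := subsetP (cq x Hx) y yqx.
  have [t tqn yxt] := hmul_assocr hypH Hx Hq (hclosed_sub cN Nn) exq yen.
  apply/lcosP; exists t => //; apply: (hclosedM hypH cQ Qq _ tqn).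
  exact: subsetP Nn.
- have tower : p = lcos_index H (P :&: Q) Q * lcos_index H N (P :&: Q).
    by rewrite -idxNQ; apply: lcos_index_tower; rewrite ?subsetIr // subsetI sNP.
  have : lcos_index H (P :&: Q) Q %| p by rewrite tower dvdn_mulr.
  move/(primeP p_pr).2/pred2P=> [idx1|idxp].
    have := lcos_index_eq1 hypH cPQ cQ (subsetIr _ _) idx1.
    by rewrite subsetI => /andP[].
  (* otherwise p n_P, the valency of QP, divides n_H *)
  have sFH : hmulS H Q P \subset car H.
    by apply: (hmulS_sub hypH); [case/and3P: cQ | case/and3P: cP].
  have [[_ cF _ _] _] := snP.
  have rtcar := residually_thin_has_valency hypH rtH.
  have [n rtn] := has_valency_sub hypH rtcar cF sFH.
  have rtF := has_valency_step rtP snP; rewrite (has_valency_uniq hypH rtn rtF).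
  rewrite -(lcos_index_mul hypH snP cQ sQF) idxp vH dvdn_pmul2l ?(negPf p'm) //.
  by rewrite expn_gt0 prime_gt0.
rewrite properE sNQ; apply/negP=> sQN.
have eQN : Q = N by apply/eqP; rewrite eqEsubset sQN.
by have := p_pr; rewrite -idxNQ eQN lcos_index_id.
Qed.

Lemma sylow_snormal : snormal H N (car H) -> ~~ (p %| #|car (hquot H N)|) ->
  P = N.
Proof.
move=> snN p'; have [k [m [cP rtP vH p'm]]] := sylow_has_valency.
have sPH : P \subset car H by case/and3P: cP.
have snNP := snormalW hypH snN cP sNP sPH.
have [n rtN en] := has_valency_snormal hypH rtP snNP.
have lcos_index_dvd : lcos_index H N P %| #|car (hquot H N)|.
  by rewrite card_quot // (lcos_index_tower hypH snN cP) // dvdn_mull.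
have : lcos_index H N P %| p ^ k by rewrite en dvdn_mull.
case/(dvdn_pfactor _ _ p_pr)=> [[|j] _ idxp].
  by apply/eqP; rewrite eqEsubset sNP andbT; apply: (lcos_index_eq1 hypH cN cP).
by case/negP: p'; apply: dvdn_trans lcos_index_dvd; rewrite idxp expnS dvdn_mulr.
Qed.

End Sylow.

Theorem theorem1p12 (T : finType) (H : hyperstruct T) (p : nat) :
  hypergroup H ->
  weakly_nilpotent H ->
  residually_thin H ->
  prime p ->
  p %| valency H ->
  p_valenced p H ->
  forall P : {set T}, sylow_subset p H P -> strongly_normal H P.
Proof.
move=> hypH [n eZ] rtH p_pr _ pvalH P sylP.
have [k [m [cP rtP vH p'm]]] := sylow_has_valency hypH rtH sylP.
pose good N := hnormal H N && (N \subset P).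
have good1 : good [set hone H].
  rewrite /good sub1set (hclosed1 hypH cP) andbT; apply/hnormalP.
  exact: (upper_center_normal hypH 0).
have [N /maxsetP[/andP[nrmN sNP] maxN] _] := maxset_exists good1.
have /hnormalP[cN nN] := nrmN.
have hypQ := hypergroup_quot hypH cN.
have [l rtN ldvd] := has_valency_sub hypH rtP cN sNP.
(* the valency of N is a power of p, so that U = N is an instance of the
   hypothesis that H is p-valenced *)
have pvalQ X : X \in car (hquot H N) ->
    hmul (hquot H N) (hinv (hquot H N) X) X \subset thin_elts (hquot H N) ->
  p_number p #|hmul (hquot H N) (hinv (hquot H N) X) X|.
  move=> /dcoset_car[h Hh ->]; rewrite hinv_quot //.
  apply: (pvalH h Hh N cN).
    exists [:: car H]; split=> //=.
    by rewrite andbT /subnormal_step subhyper_car (hclosed_car hypH).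
  rewrite (valency_has_valency hypH cN rtN).
  by have [j _ ->] := dvdn_pfactor _ _ p_pr ldvd; exists j.
have csQ := central_series_quot hypH cN nN (upper_central_series hypH eZ).
have [[C [cC sCZ oC]]|/andP[/andP[_ thQ] p'Q]] :=
  central_series_dichotomy hypQ p_pr csQ pvalQ.
  have [Q [nrmQ sQP]] :=
    central_extension_in_sylow hypH p_pr rtH sylP cN nN sNP cC sCZ oC.
  rewrite properE => /andP[sNQ]; rewrite (maxN Q) ?subxx //.
  by rewrite /good nrmQ.
have snN : snormal H N (car H).
  apply/(thin_quotP hypH cN); rewrite /thin eqEsubset thQ.
  by apply/subsetP=> X; rewrite inE => /andP[].
rewrite (sylow_snormal hypH p_pr rtH sylP cN nN sNP snN p'Q).
by have /(snormalP hypH _ (hclosed_car hypH)) := snN; rewrite subhyper_car.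
Qed.
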